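(* Let $n\in\{2,3\}$ and let $\Gamma\subset\mathbb{R}^n$ be a compact $C^2$ hypersurface, i.e. of codimension $1$ (a curve if $n=2$, a surface if $n=3$), either closed or open. Let $d$ be the distance function associated with $\Gamma$ (signed if $\Gamma$ is closed, unsigned if $\Gamma$ is open), let $P_\Gamma$ be the closest point mapping onto $\Gamma$, and let $P'_\Gamma$ be its Jacobian matrix. For $|\eta|$ sufficiently close to zero, let $\Gamma_\eta=\{\mathbf{x} : d(\mathbf{x})=\eta\}$ be the $\eta$-level set of $d$, and define $$J_\eta=\begin{cases}1+\eta\kappa_\eta, & n=2,\\ 1+2\eta H_\eta+\eta^2G_\eta, & n=3,\end{cases}$$ where $\kappa_\eta$ is the signed curvature of $\Gamma_\eta$ if $n=2$, and $H_\eta$ and $G_\eta$ are the mean curvature and the Gaussian curvature of $\Gamma_\eta$ if $n=3$. Then, on $\Gamma_\eta$, $$J_\eta=\begin{cases}\sigma_1, & n=2,\\ \sigma_1\sigma_2, & n=3,\end{cases}$$ where $\sigma_1,\sigma_2$ are the first two singular values of the Jacobian matrix $P'_\Gamma$.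
   Context: If $\Gamma$ is closed, it is the boundary $\partial\Omega$ of a domain $\Omega\subset\mathbb{R}^n$, and $d$ is the signed distance function: $d(\mathbf{x})=\inf_{\mathbf{y}\in\Omega^c}|\mathbf{x}-\mathbf{y}|$ for $\mathbf{x}\in\Omega$ and $d(\mathbf{x})=-\inf_{\mathbf{y}\in\Omega}|\mathbf{x}-\mathbf{y}|$ for $\mathbf{x}\in\bar\Omega^c$ (so $d=0$ on $\Gamma$ and $d>0$ inside $\Omega$). If $\Gamma$ is open (not closed), it is assumed to have smooth boundaries, and $d(\mathbf{x})=\min_{\mathbf{y}\in\Gamma}|\mathbf{x}-\mathbf{y}|$ is the ordinary distance function. The closest point mapping $P_\Gamma:\mathbb{R}^n\to\Gamma$ is defined by $|P_\Gamma(\mathbf{x})-\mathbf{x}|=\min_{\mathbf{y}\in\Gamma}|\mathbf{y}-\mathbf{x}|$. Sign convention for curvatures of the level sets of $d$: $\Delta d=(1-n)H$, where $H$ is the mean curvature of the level set through the point; that is, $\kappa_\eta=-\Delta d$ on $\Gamma_\eta$ for $n=2$, and $H_\eta=-\tfrac12\Delta d$ on $\Gamma_\eta$ for $n=3$. $G_\eta$ is the usual Gaussian curvature of $\Gamma_\eta$. Singular values are listed in decreasing order.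
   Formalization: For open Γ, P_Γ is not differentiable at points of Γ_η where the part normal to Γ meets the cap around its boundary, so P'_Γ is undefined there; the formula is stated where P_Γ is differentiable, and this is asserted whenever the closest point is an interior point of Γ. *)

(* Defs.v *)
(* MathComp-Analysis. *)
From HB Require Import structures.
From mathcomp Require Import all_boot all_order all_algebra.
From mathcomp Require Import all_classical all_reals all_analysis.

Set Implicit Arguments.
Unset Strict Implicit.
Unset Printing Implicit Defensive.

Import Order.TTheory GRing.Theory Num.Theory.
Import numFieldNormedType.Exports.

Local Open Scope classical_set_scope.
Local Open Scope ring_scope.

(* Points of R^n are row vectors.  The library norm on 'rV[R]_n is the sup norm,
   which induces the same topology and the same notion of differentiability, but
   distances have to be measured with the Euclidean norm. *)
Definition enorm (R : realType) (n : nat) (v : 'rV[R]_n) : R :=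
  Num.sqrt (\sum_i v ord0 i ^+ 2).

(* To be used with [U] open only. *)
Definition C1_on (R : realType) (n k : nat) (U : set 'rV[R]_n.+1)
    (f : 'rV[R]_n.+1 -> 'rV[R]_k.+1) : Prop :=
  (forall x, U x -> differentiable f x) /\
  (forall v x, U x -> {for x, continuous ('D_v f)}).

Definition C2_on (R : realType) (n k : nat) (U : set 'rV[R]_n.+1)
    (f : 'rV[R]_n.+1 -> 'rV[R]_k.+1) : Prop :=
  C1_on U f /\ (forall v, C1_on U ('D_v f)).

Definition C2_diffeomorphism (R : realType) (n : nat)
    (U V : set 'rV[R]_n.+1) (Phi Psi : 'rV[R]_n.+1 -> 'rV[R]_n.+1) : Prop :=
  [/\ open U, open V, C2_on U Phi & C2_on V Psi] /\
  [/\ forall x, U x -> V (Phi x), forall y, V y -> U (Psi y),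
      forall x, U x -> Psi (Phi x) = x & forall y, V y -> Phi (Psi y) = y].

(* Embedded m-dimensional C^2 hypersurfaces with (possibly empty) C^2 boundary in
   R^(m+1), m >= 1, through flattening charts: near an interior point the chart
   carries Gamma onto the hyperplane {y_m = 0}, near a boundary point onto the
   half-hyperplane {y_m = 0, y_0 >= 0}, the point itself lying on {y_0 = 0}. *)
Definition hypersurface_interior (R : realType) (m : nat)
    (Gamma : set 'rV[R]_m.+1) : set 'rV[R]_m.+1 :=
  [set p | Gamma p /\ exists U V Phi Psi,
    [/\ C2_diffeomorphism U V Phi Psi, U p &
        forall x, U x -> (Gamma x <-> Phi x ord0 ord_max = 0)]].

Definition hypersurface_boundary (R : realType) (m : nat)
    (Gamma : set 'rV[R]_m.+1) : set 'rV[R]_m.+1 :=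
  [set p | Gamma p /\ exists U V Phi Psi,
    [/\ C2_diffeomorphism U V Phi Psi, U p, Phi p ord0 ord0 = 0 &
        forall x, U x ->
          (Gamma x <-> Phi x ord0 ord_max = 0 /\ 0 <= Phi x ord0 ord0)]].

Definition compact_C2_hypersurface (R : realType) (m : nat)
    (Gamma : set 'rV[R]_m.+1) : Prop :=
  compact Gamma /\
  Gamma `<=` hypersurface_interior Gamma `|` hypersurface_boundary Gamma.

(* "Closed" as in "closed curve", i.e. without boundary. *)
Definition closed_hypersurface (R : realType) (m : nat)
    (Gamma : set 'rV[R]_m.+1) : Prop :=
  Gamma `<=` hypersurface_interior Gamma.

Definition distance_to (R : realType) (n : nat) (A : set 'rV[R]_n)
    (x : 'rV[R]_n) : R :=
  inf [set enorm (x - y) | y in A].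

Definition signed_distance (R : realType) (n : nat) (Omega : set 'rV[R]_n)
    (x : 'rV[R]_n) : R :=
  if x \in Omega then distance_to (~` Omega) x
  else if x \in ~` closure Omega then - distance_to Omega x
  else 0.

Definition domain (R : realType) (n : nat) (Omega : set 'rV[R]_n) : Prop :=
  [/\ open Omega, connected Omega & Omega !=set0].

Definition is_distance_function (R : realType) (m : nat)
    (Gamma : set 'rV[R]_m.+1) (d : 'rV[R]_m.+1 -> R) : Prop :=
  (closed_hypersurface Gamma /\
   exists Omega, [/\ domain Omega, closure Omega `\` interior Omega = Gamma &
                     forall x, d x = signed_distance Omega x]) \/
  (~ closed_hypersurface Gamma /\ forall x, d x = distance_to Gamma x).

Definition closest_point_map (R : realType) (n : nat) (Gamma : set 'rV[R]_n)
    (P : 'rV[R]_n -> 'rV[R]_n) : Prop :=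
  forall x, Gamma (P x) /\
            forall y, Gamma y -> enorm (P x - x) <= enorm (y - x).

Definition level_set (R : realType) (n : nat) (f : 'rV[R]_n -> R) (eta : R) :
    set 'rV[R]_n :=
  [set x | f x = eta].

Definition gradient (R : realType) (n : nat) (f : 'rV[R]_n.+1 -> R)
    (x : 'rV[R]_n.+1) : 'rV[R]_n.+1 :=
  \row_i 'D_(delta_mx ord0 i) f x.

(* Unit normal field of the level sets of f, pointing to where f increases. *)
Definition gauss_map (R : realType) (n : nat) (f : 'rV[R]_n.+1 -> R)
    (x : 'rV[R]_n.+1) : 'rV[R]_n.+1 :=
  (enorm (gradient f x))^-1 *: gradient f x.

(* The row space of this matrix is the orthogonal complement of the gradient. *)
Definition tangent_space (R : realType) (n : nat) (f : 'rV[R]_n.+1 -> R)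
    (x : 'rV[R]_n.+1) : 'M[R]_n.+1 :=
  kermx (gradient f x)^T.

(* Matrix, in a basis of the tangent space, of the Weingarten map v |-> - dN(v),
   N being the Gauss map.  When f is a distance function, f increases towards
   the inside, so that spheres bounding balls have positive curvatures; since
   then |grad f| = 1, the trace is - Delta f, that is Delta f = (1 - n) H in R^n.
   ['J] acts on row vectors on the right: v *m 'J N x = dN_x(v). *)
Definition shape_operator (R : realType) (n : nat) (f : 'rV[R]_n.+1 -> R)
    (x : 'rV[R]_n.+1) : 'M[R]_(\rank (tangent_space f x)) :=
  restrictmx (tangent_space f x) (- 'J (gauss_map f) x).

(* To be used in R^2, where the shape operator is a 1 x 1 matrix. *)
Definition signed_curvature (R : realType) (n : nat) (f : 'rV[R]_n.+1 -> R)
    (x : 'rV[R]_n.+1) : R :=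
  \tr (shape_operator f x).

Definition mean_curvature (R : realType) (n : nat) (f : 'rV[R]_n.+1 -> R)
    (x : 'rV[R]_n.+1) : R :=
  n%:R^-1 * \tr (shape_operator f x).

Definition gaussian_curvature (R : realType) (n : nat) (f : 'rV[R]_n.+1 -> R)
    (x : 'rV[R]_n.+1) : R :=
  \det (shape_operator f x).

(* J_eta, for hypersurfaces of dimension m = 1 (n = 2) or m = 2 (n = 3). *)
Definition J_factor (R : realType) (m : nat) (d : 'rV[R]_m.+1 -> R)
    (eta : R) (x : 'rV[R]_m.+1) : R :=
  if m == 1%N then 1 + eta * signed_curvature d x
  else 1 + 2 * eta * mean_curvature d x + eta ^+ 2 * gaussian_curvature d x.

(* s lists the singular values of A with multiplicity, in decreasing order. *)
Definition singular_values (R : realType) (p q : nat) (A : 'M[R]_(p, q))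
    (s : seq R) : Prop :=
  [/\ sorted >=%R s, all (fun a => 0 <= a) s &
      char_poly (A^T *m A) = \prod_(a <- s) ('X - (a ^+ 2)%:P)].

(* Main.v *)
Require Import Defs.
From HB Require Import structures.
From mathcomp Require Import all_boot all_order all_algebra.
From mathcomp Require Import all_classical all_reals all_analysis.
From mathcomp Require Import polyrcf ring lra.

Set Implicit Arguments.
Unset Strict Implicit.
Unset Printing Implicit Defensive.

Import Order.TTheory GRing.Theory Num.Theory.
Import numFieldNormedType.Exports.

Local Open Scope classical_set_scope.
Local Open Scope ring_scope.

(** Let P be the closest point mapping. Everything rests on one inequality,
[normal_bound]: there is K such that, for p nearest to x and q in Gamma,
<x - p, q - p> <= K |x - p| |q - p|^2. A chart maps Gamma to a convex subset of
a hyperplane (a half-hyperplane near a boundary point), so the segment joining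
the images of p and q is the image of a curve in Gamma from p to q. Since p is
nearest, x - p makes a nonpositive product with the initial velocity of this
curve, and by Taylor's formula q - p differs from this velocity by at most a
multiple of |q - p|^2. Compactness of Gamma makes K uniform. Interior and
boundary points of Gamma are thus treated alike.

Let the tube be the set where 4 K |x - P x| < 1; the conclusion is proved for all
4 K |eta| < 1. Adding the inequality for two points of the tube shows that P is
2-Lipschitz there. Hence |x - P x|^2, which is the square of d (for the signed
distance because a segment that leaves Omega crosses Gamma), has the derivative
2 <x - P x, .>. Off Gamma, d is therefore differentiable with the gradient
(x - P x) / d x, a unit vector, which is the Gauss map.

Off Gamma ([J_factor_off]), let P be differentiable at x and d x = eta. On the
tangent space T of the level set, orthogonal to x - P x, the derivative of the Gauss
map N is (1 - P') / eta, that is, P' = 1 + eta S with S the shape operator. As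
P is constant on the segment from x to P x, and P x minimizes the distance to x,
P' kills x - P x and takes its values in T. So P' is the direct sum of 1 + eta S and
of zero, along the orthogonal sum of T and its normal, and the product of its first m
singular values is |det (1 + eta S)|. The determinant is nonnegative because P
is monotone, and its expansion for m = 1, 2 is J_eta.

On Gamma ([J_factor_on]), J is 1. At an interior point P' is the orthogonal
projection onto the tangent space, whose first m singular values are 1. At a boundary
point P is not differentiable: the first coordinate of the chart composed with P
would have a minimum there, while P fixes a curve along which this coordinate
grows at unit speed.

Finally ([proj_differentiable]), let P x be an interior point of Gamma, and b be P read
in a chart with inverse Psi. Then b y is a critical point of |y - Psi|^2 on
the hyperplane. Let E be the gradient in b of half of this function at y = x, up to
sign, completed by the normal coordinate. The critical point equation shows that
E \o b is differentiable at x, and [normal_bound] that the derivative of E at b x is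
injective: otherwise the squared distance to x would be constant to second order
along a curve of Gamma through P x, whereas it grows quadratically. As b is
Lipschitz, it is differentiable at x, and so is P. *)

(** * Singular values of a matrix with a common left and right kernel vector *)

Lemma char_poly_tr (F : fieldType) n (A : 'M[F]_n) : char_poly A^T = char_poly A.
Proof.
rewrite /char_poly -det_tr; congr (\det _).
by apply/matrixP=> i j; rewrite !mxE eq_sym.
Qed.

Lemma char_poly_similar (F : fieldType) n (W A D : 'M[F]_n) :
  W \in unitmx -> W *m A = D *m W -> char_poly A = char_poly D.
Proof.
move=> Wu WA; apply/eqP.
have d0 : \det (map_mx (@polyC F) W) != 0.
  by rewrite det_map_mx polyC_eq0 -unitfE -unitmxE.
rewrite -(inj_eq (mulfI d0)) /char_poly -!det_mulmx.
rewrite [X in _ == X]det_mulmx mulrC -det_mulmx.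
apply/eqP; congr (\det _); rewrite /char_poly_mx mulmxBr mulmxBl.
by rewrite -!map_mxM WA scalar_mxC.
Qed.

(** In the basis formed by the rows of B and by u, the matrix A is diag (S, 0). *)
Lemma char_poly_split (F : fieldType) r (A : 'M[F]_(r + 1)) B (S : 'M[F]_r)
    (u : 'rV[F]_(r + 1)) :
  col_mx B u \in unitmx -> B *m A = S *m B -> u *m A = 0 ->
  char_poly A = char_poly S * 'X.
Proof.
move=> Wu BA uA.
rewrite (@char_poly_similar _ _ (col_mx B u) _ (block_mx S 0 0 0)) //; last first.
  by rewrite mul_col_mx BA uA mul_block_col !mul0mx !addr0.
rewrite /char_poly char_block_diag_mx det_ublock; congr (_ * _).
by rewrite [X in \det X]mx11_scalar det_scalar1 !mxE subr0.
Qed.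

(** The characteristic polynomial of - S is monic, has no positive root, and takes
the value \det S at 0. *)
Lemma det_ge0_of_no_neg_eigenvalue (R : realType) r (S : 'M[R]_r) :
  (forall a (v : 'rV_r), v *m S = a *: v -> v != 0 -> 0 <= a) -> 0 <= \det S.
Proof.
move=> Sge0; set p := char_poly (- S).
have p0 : p.[0] = \det S.
  rewrite horner_coef0 char_poly_det -[- S]scaleN1r detZ mulrA -exprMn.
  by rewrite mulrNN mulr1 expr1n mul1r.
have lp : lead_coef p = 1 by apply/monicP; exact: char_poly_monic.
rewrite -p0 leNgt; apply/negP => pneg.
have [b bP] : exists b, forall x, b <= x -> lead_coef p <= p.[x].
  by apply: poly_pinfty_gt_lc; rewrite lp.
have [||t /andP[t0 _] rt] := @poly_ivt R p 0 (Num.max 0 b).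
- by rewrite le_max lexx.
- by rewrite (ltW pneg) /= (le_trans _ (bP _ _)) ?lp// le_max lexx orbT.
have tn0 : t != 0.
  by apply: contraTneq rt => ->; rewrite /root lt_eqF.
move: rt; rewrite -eigenvalue_root_char => /eigenvalueP[v vS v0].
have vSt : v *m S = - t *: v by rewrite scaleNr -vS mulmxN opprK.
by have := Sge0 _ _ vSt v0; rewrite oppr_ge0 leNgt lt0r tn0 t0.
Qed.

Lemma prodN_sqr (F : comNzRingType) (s : seq F) :
  \prod_(a <- s) (- a ^+ 2) = (-1) ^+ size s * (\prod_(a <- s) a) ^+ 2.
Proof.
elim: s => [|a s IHs]; first by rewrite !big_nil /= expr0 expr1n mulr1.
rewrite !big_cons IHs /= [(-1) ^+ _.+1]exprS exprMn.
by rewrite mulN1r !mulNr mulrCA.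
Qed.

(** A and A^T both preserve the orthogonal complement of u, where they act in
the basis B by S and by some S2 with the same determinant. Hence the
characteristic polynomial of A^T A is that of S2 S times X: one singular
value is 0, necessarily the last one, and the squares of the others have the product
(\det S) ^ 2. The sign comes from the nonnegativity of the quadratic form of A. *)
Lemma singular_values_kernel (R : realType) r n (A : 'M[R]_n)
    (B : 'M[R]_(r, n)) (S : 'M[R]_r) (u : 'rV[R]_n) (s : seq R) :
  (r + 1)%N = n -> row_free (col_mx B u) ->
  (kermx u^T <= B)%MS -> B *m u^T = 0 ->
  u *m A = 0 -> A *m u^T = 0 -> B *m A = S *m B ->
  (forall v : 'rV[R]_n, 0 <= (v *m A *m v^T) 0 0) ->
  singular_values A s -> \det S = \prod_(i < r) s`_i.
Proof.
move=> rn; case: n / rn in A B u *; rewrite row_free_unit.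
move=> Wu kB Bu uA Au BA Age0 [ssort sge0 schar].
have X0 : 'X != 0 :> {poly R} by rewrite polyX_eq0.
have Bfree : row_free B.
  apply/row_freeP; exists (lsubmx (invmx (col_mx B u))).
  have := mulmxV Wu; rewrite -[invmx _]hsubmxK mul_col_row.
  by rewrite [1%:M]scalar_mx_block => /eq_block_mx[] + _ _ _; rewrite row_mxKl.
have [S2 BAT] : exists S2, B *m A^T = S2 *m B.
  apply/submxP; apply: submx_trans kB; apply/sub_kermxP.
  by rewrite -mulmxA -trmx_mul uA trmx0 mulmx0.
have uAT : u *m A^T = 0 by rewrite -[u]trmxK -trmx_mul Au trmx0.
have detS2 : \det S2 = \det S.
  have e1 := char_poly_split Wu BA uA; have e2 := char_poly_split Wu BAT uAT.
  have : char_poly S2 * 'X = char_poly S * 'X by rewrite -e1 -e2 char_poly_tr.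
  move/(mulIf X0)/(congr1 (fun p : {poly R} => p`_0)); rewrite !char_poly_det.
  by move/eqP; rewrite (inj_eq (mulfI _)) ?signr_eq0 // => /eqP.
have detS : 0 <= \det S.
  apply: det_ge0_of_no_neg_eigenvalue => a v vS v0.
  have w0 : v *m B != 0 by rewrite (mulmx_free_eq0 _ Bfree).
  have wA : v *m B *m A = a *: (v *m B) by rewrite -mulmxA BA mulmxA vS scalemxAl.
  have := Age0 (v *m B); rewrite wA -scalemxAl mxE pmulr_lge0 // lt_neqAle.
  rewrite mxE [X in _ && X]sumr_ge0 ?andbT; last by move=> i _; rewrite !mxE -expr2 sqr_ge0.
  rewrite eq_sym psumr_neq0; last by move=> i _; rewrite !mxE -expr2 sqr_ge0.
  case/rV0Pn: w0 => i wi; apply/hasP; exists i; rewrite ?mem_index_enum//=.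
  by rewrite [(_^T) _ _]mxE -expr2 exprn_even_gt0.
have ATA : char_poly (A^T *m A) = char_poly (S2 *m S) * 'X.
  apply: (char_poly_split Wu); first by rewrite mulmxA BAT -!mulmxA BA.
  by rewrite mulmxA uAT mul0mx.
have sz : size s = r.+1.
  apply: succn_inj; rewrite -(size_prod_XsubC s (fun a => a ^+ 2)) -schar.
  by rewrite size_char_poly addn1.
case/lastP: s => [|s l] // in ssort sge0 schar sz *.
move: sz; rewrite size_rcons => -[sz].
(* 0 is a root of the characteristic polynomial, so some singular value is 0. *)
have l0 : l = 0.
  have := congr1 (horner^~ 0) schar; rewrite ATA hornerM hornerX mulr0.
  move/esym/eqP; rewrite -/(root _ _) -(big_map (fun a => a ^+ 2) xpredT (fun a => 'X - a%:P)).
  rewrite root_prod_XsubC => /mapP[a ains /esym/eqP]; rewrite sqrf_eq0 => /eqP a0.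
  move: ssort sge0; rewrite sorted_pairwise; last by move=> ? ? ? /[swap]; exact: le_trans.
  rewrite pairwise_rcons all_rcons => /andP[/allP lmin _] /andP[lge0 _].
  apply/eqP; rewrite eq_le lge0 andbT.
  by move: ains; rewrite mem_rcons inE => /orP[/eqP <-|/lmin]; rewrite a0.
have := schar; rewrite ATA big_rcons l0 expr0n /= subr0.
move/(mulIf X0) => /(congr1 (horner^~ 0)).
rewrite horner_coef0 char_poly_det det_mulmx detS2 horner_prod.
under eq_bigr do rewrite hornerXsubC sub0r.
rewrite prodN_sqr sz => /eqP; rewrite (inj_eq (mulfI _)) ?signr_eq0 // -expr2.
move: ssort sge0 => _; rewrite all_rcons => /andP[_ /allP sge0].
have p0 : 0 <= \prod_(a <- s) a.
  by rewrite big_seq; apply: prodr_ge0 => a /sge0.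
rewrite eqrXn2 // => /eqP ->; rewrite (big_nth 0) big_mkord sz.
by apply: eq_bigr => i _; rewrite nth_rcons sz ltn_ord.
Qed.

Lemma det_restrict_kernel (R : realType) m (A : 'M[R]_m.+1) (u : 'rV[R]_m.+1)
    (S : 'M[R]_(\rank (kermx u^T))) (s : seq R) :
  u != 0 -> u *m A = 0 -> A *m u^T = 0 ->
  row_base (kermx u^T) *m A = S *m row_base (kermx u^T) ->
  (forall v : 'rV[R]_m.+1, 0 <= (v *m A *m v^T) 0 0) ->
  singular_values A s -> \det S = \prod_(i < m) s`_i.
Proof.
move=> u0 uA Au BA Age0 sA.
have rk : \rank (kermx u^T) = m.
  rewrite mxrank_ker mxrank_tr rank_rV u0 subn1 //.
have Bu : row_base (kermx u^T) *m u^T = 0.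
  by apply/sub_kermxP; rewrite eq_row_base.
have kB : (kermx u^T <= row_base (kermx u^T))%MS by rewrite eq_row_base.
have Bfree := row_base_free (kermx u^T).
move: (row_base _) Bfree BA Bu kB => B; move: S B.
rewrite rk => {rk} S B Bfree BA Bu kB.
have Wu : row_free (col_mx B u).
  rewrite /row_free -addsmxE mxrank_disjoint_sum.
    by rewrite (eqP Bfree) rank_rV u0 addn1.
  apply/eqP/rowV0P=> v; rewrite sub_capmx => /andP[/submxP[a ->] /sub_rVP[c vc]].
  have : (c *: u) *m u^T = 0 by rewrite -vc -mulmxA Bu mulmx0.
  move/matrixP/(_ 0 0)/eqP; rewrite -scalemxAl mxE [X in _ == X]mxE vc mulf_eq0.
  case/orP => [/eqP ->|]; first by rewrite scale0r.
  rewrite mxE psumr_eq0; last by move=> i _; rewrite mxE -expr2 sqr_ge0.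
  move=> /allP h; case/rV0Pn: u0 => i; have := h i (mem_index_enum _).
  by rewrite mxE mulf_eq0 orbb /= => ->.
exact: (singular_values_kernel (addn1 m) Wu kB Bu uA Au BA Age0 sA).
Qed.

(** * Differentiability through linear approximation *)

Lemma differentiable_approx (R : realType) (V W : normedModType R) (f : V -> W) x :
  differentiable f x -> forall e, 0 < e ->
  \forall y \near x, `|f y - f x - 'd f x (y - x)| <= e * `|y - x|.
Proof.
move=> [[_ fE]] e e0; have /eqaddoP/(_ e e0) := fE.
apply: filterS => y; rewrite lim_id // /= => h.
by rewrite -addrA -opprD.
Qed.

Lemma approx_is_diff (R : realType) (V W : normedModType R) (f : V -> W) x
    (L : {linear V -> W}) : continuous L ->
  (forall e, 0 < e -> \forall y \near x, `|f y - f x - L (y - x)| <= e * `|y - x|) ->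
  is_diff x f L.
Proof.
move=> cL fL; have fE : f \o shift x = cst (f x) + L +o_ 0 id.
  apply/eqaddoP => e e0; have := fL e e0; rewrite (near_shift 0) subr0.
  apply: filterS => h; rewrite /= addrK => h1.
  by rewrite !fctE /= opprD addrA.
have dE := diff_unique cL fE.
by split => //; apply/diff_locallyP; rewrite dE.
Qed.

(** * Euclidean geometry of row vectors *)

Definition dot (R : realType) n (u v : 'rV[R]_n) : R := \sum_i u ord0 i * v ord0 i.

Section Dot.
Variables (R : realType) (n : nat).
Implicit Types u v w : 'rV[R]_n.

Lemma dotC u v : dot u v = dot v u.
Proof. by apply: eq_bigr => i _; rewrite mulrC. Qed.

Lemma dot_mx u v : dot u v = (u *m v^T) 0 0.
Proof. by rewrite mxE; apply: eq_bigr => i _; rewrite !mxE. Qed.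

Lemma dotDl u v w : dot (u + v) w = dot u w + dot v w.
Proof. by rewrite !dot_mx mulmxDl mxE. Qed.

Lemma dotZl c u v : dot (c *: u) v = c * dot u v.
Proof. by rewrite !dot_mx -scalemxAl mxE. Qed.

Lemma dotNl u v : dot (- u) v = - dot u v.
Proof. by rewrite -scaleN1r dotZl mulN1r. Qed.

Lemma dotBl u v w : dot (u - v) w = dot u w - dot v w.
Proof. by rewrite dotDl dotNl. Qed.

Lemma dotDr u v w : dot w (u + v) = dot w u + dot w v.
Proof. by rewrite dotC dotDl !(dotC w). Qed.

Lemma dotZr c u v : dot u (c *: v) = c * dot u v.
Proof. by rewrite dotC dotZl dotC. Qed.

Lemma dotNr u v : dot u (- v) = - dot u v.
Proof. by rewrite dotC dotNl dotC. Qed.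

Lemma dotBr u v w : dot w (u - v) = dot w u - dot w v.
Proof. by rewrite dotDr dotNr. Qed.

Lemma dot0l u : dot 0 u = 0.
Proof. by rewrite -(scale0r 0) dotZl mul0r. Qed.

Definition dotE := (dotBl, dotBr, dotDl, dotDr, dotNl, dotNr, dotZl, dotZr).

Lemma dot_ge0 u : 0 <= dot u u.
Proof. by apply: sumr_ge0 => i _; rewrite -expr2 sqr_ge0. Qed.

Lemma dot_eq0 u : (dot u u == 0) = (u == 0).
Proof.
apply/eqP/eqP => [|->]; last by rewrite dot0l.
move/eqP; rewrite psumr_eq0 => [/allP h|i _]; last by rewrite -expr2 sqr_ge0.
apply/rowP => i; have := h i (mem_index_enum _).
by rewrite /= mulf_eq0 orbb mxE => /eqP.
Qed.

Lemma enorm_ge0 u : 0 <= enorm u.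
Proof. exact: sqrtr_ge0. Qed.

Lemma enorm_sqr u : enorm u ^+ 2 = dot u u.
Proof.
rewrite sqr_sqrtr; first by apply: eq_bigr => i _; rewrite expr2.
by apply: sumr_ge0 => i _; rewrite sqr_ge0.
Qed.

Lemma enorm_eq0 u : (enorm u == 0) = (u == 0).
Proof. by rewrite -dot_eq0 -enorm_sqr sqrf_eq0. Qed.

Lemma enorm_gt0 u : (0 < enorm u) = (u != 0).
Proof. by rewrite lt_def enorm_eq0 enorm_ge0 andbT. Qed.

Lemma ler_enorm u v : (enorm u <= enorm v) = (dot u u <= dot v v).
Proof. by rewrite -!enorm_sqr ler_sqr ?nnegrE ?enorm_ge0. Qed.

Lemma enormN u : enorm (- u) = enorm u.
Proof. by apply/eqP; rewrite eq_le !ler_enorm !dotE opprK lexx. Qed.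

Lemma enormB u v : enorm (u - v) = enorm (v - u).
Proof. by rewrite -enormN opprB. Qed.

Lemma enormZ c u : enorm (c *: u) = `|c| * enorm u.
Proof.
apply/eqP; rewrite -(@eqrXn2 _ 2) ?enorm_ge0 // ?mulr_ge0 ?enorm_ge0 //.
by rewrite exprMn !enorm_sqr !dotE -normrX ger0_norm ?sqr_ge0 // mulrA expr2.
Qed.

Lemma dot_cauchy_schwarz u v : dot u v <= enorm u * enorm v.
Proof.
have [->|u0] := eqVneq u 0; first by rewrite dot0l mulr_ge0 ?enorm_ge0.
have [->|v0] := eqVneq v 0; first by rewrite dotC dot0l mulr_ge0 ?enorm_ge0.
have := dot_ge0 (enorm v *: u - enorm u *: v).
rewrite !dotE -!enorm_sqr (dotC v u).
have : 0 < enorm u * enorm v by rewrite mulr_gt0 ?enorm_gt0.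
move: (enorm u) (enorm v) (dot u v) => a b c ab h.
have : 0 <= (a * b) * (a * b - c) by nra.
by rewrite pmulr_rge0 // subr_ge0.
Qed.

Lemma normr_dot_le u v : `|dot u v| <= enorm u * enorm v.
Proof.
rewrite ler_norml dot_cauchy_schwarz andbT -(enormN u) lerNl -dotNl.
exact: dot_cauchy_schwarz.
Qed.

Lemma enorm_triangle u v : enorm (u + v) <= enorm u + enorm v.
Proof.
rewrite -(@ler_sqr _ (enorm _)) ?nnegrE ?addr_ge0 ?enorm_ge0 // sqrrD !enorm_sqr !dotE.
have := dot_cauchy_schwarz u v; rewrite (dotC v u) mulr2n; lra.
Qed.

Lemma coord_le_norm u i : `|u ord0 i| <= `|u|.
Proof.
rewrite [X in _ <= X]mx_normrE.
by apply: le_trans (le_bigmax _ _ (ord0, i)) => /=.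
Qed.

Lemma norm_le_enorm u : `|u| <= enorm u.
Proof.
rewrite [X in X <= _]mx_normrE; apply: bigmax_le => [|[i j] _]; first exact: enorm_ge0.
rewrite -ler_sqr ?nnegrE ?enorm_ge0 // enorm_sqr /= ord1.
rewrite /dot (bigD1 j) //= -normrX ger0_norm ?sqr_ge0 // expr2 lerDl.
by apply: sumr_ge0 => k _; rewrite -expr2 sqr_ge0.
Qed.

Lemma enorm_le_norm u : enorm u <= n%:R * `|u|.
Proof.
rewrite -ler_sqr ?nnegrE ?enorm_ge0 ?mulr_ge0 // enorm_sqr /dot.
have h : dot u u <= n%:R * `|u| ^+ 2.
  rewrite -[n in n%:R]card_ord -sum1_card natr_sum mulr_suml.
  apply: ler_sum => i _; rewrite mul1r -expr2 -real_normK ?num_real //.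
  by rewrite lerXn2r ?nnegrE ?coord_le_norm.
apply: (le_trans h); rewrite exprMn; apply: ler_wpM2r; rewrite ?sqr_ge0 //.
by rewrite -natrX ler_nat; case: (n) => // k; rewrite leq_pmulr.
Qed.

End Dot.

Lemma linear_rV_continuous (R : realType) n (W : normedModType R)
  (L : {linear 'rV[R]_n -> W}) : continuous L.
Proof.
apply/linear_bounded_continuous/linear_boundedP.
exists (\sum_i `|L (delta_mx ord0 i)|); split; first exact: num_real.
move=> M hM v.
have -> : L v = \sum_i v ord0 i *: L (delta_mx ord0 i).
  by rewrite {1}(row_sum_delta v) linear_sum; apply: eq_bigr => i _; rewrite linearZ.
apply: le_trans (ler_norm_sum _ _ _) _.
apply: (@le_trans _ _ ((\sum_i `|L (delta_mx ord0 i)|) * `|v|)).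
  rewrite mulr_suml; apply: ler_sum => i _; rewrite normrZ mulrC.
  by rewrite ler_wpM2l // coord_le_norm.
by rewrite ler_wpM2r // ltW.
Qed.

(** * Taylor estimates for maps of class C1 and C2 *)

(** The product with g as a linear map, so that it can be a differential. *)
Definition dotl (R : realType) n (g v : 'rV[R]_n) : R := dot v g.

Lemma dotl_is_linear (R : realType) n (g : 'rV[R]_n) : linear (dotl g).
Proof. by move=> c u v; rewrite /dotl !dotE. Qed.

HB.instance Definition _ (R : realType) n (g : 'rV[R]_n) :=
  GRing.isLinear.Build R 'rV[R]_n R _ (dotl g) (dotl_is_linear g).

Lemma dotl_differentiable (R : realType) n (g v : 'rV[R]_n.+1) : differentiable (dotl g) v.
Proof. exact/linear_differentiable/linear_rV_continuous. Qed.

Lemma coord_dot (R : realType) n (v : 'rV[R]_n) i : v ord0 i = dot v (delta_mx ord0 i).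
Proof.
rewrite /dot (bigD1 i) //= big1 => [|j /negbTE ji]; last by rewrite !mxE eqxx ji mulr0.
by rewrite mxE !eqxx mulr1 addr0.
Qed.

Lemma differentiable_dot (R : realType) (V : normedModType R) n (g : 'rV[R]_n.+1)
    (f : V -> 'rV[R]_n.+1) x :
  differentiable f x -> differentiable (fun z => dot (f z) g) x.
Proof.
move=> df; rewrite -[X in differentiable X _]/(dotl g \o f).
by apply: differentiable_comp => //; exact: dotl_differentiable.
Qed.

Lemma diff_dot (R : realType) (V : normedModType R) n (g : 'rV[R]_n.+1)
    (f : V -> 'rV[R]_n.+1) x v :
  differentiable f x -> 'd (fun z => dot (f z) g) x v = dot ('d f x v) g.
Proof.
move=> df; have dg := @dotl_differentiable _ _ g (f x).
rewrite -[X in 'd X _]/(dotl g \o f) diff_comp // diff_lin //.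
exact: linear_rV_continuous.
Qed.

Lemma segment_MVT (R : realType) (V : normedModType R) (f : V -> R) x h :
  (forall t, 0 <= t <= 1 -> differentiable f (x + t *: h)) ->
  exists2 c, 0 < c < 1 & f (x + h) - f x = 'd f (x + c *: h) h.
Proof.
move=> df; pose g (t : R) := f (x + t *: h).
have dg (t : R) : 0 <= t <= 1 -> is_derive t 1 g ('d f (x + t *: h) h).
  move=> t01; have dft := df t t01.
  have dl : is_diff t (fun t : R => x + t *: h) ( *:%R^~ h).
    rewrite -[X in is_diff _ X _]/(cst x + ( *:%R^~ h)).
    rewrite -[X in is_diff _ _ X]add0r.
    exact: (is_diffD (is_diff_cst _ _) (is_diff_scalel _ _)).
  have dfd : differentiable f ((fun t : R => x + t *: h) t) by [].
  have dgd : differentiable g t by apply: (@differentiable_comp _ _ _ _ (fun t : R => x + t *: h)).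
  apply: DeriveDef; first exact: diff_derivable.
  rewrite deriveE // (@diff_comp _ _ _ _ (fun t : R => x + t *: h)) //.
  by rewrite diff_val /= scale1r.
have [|t t01||c c01 gc] := @MVT R g (fun t : R => 'd f (x + t *: h) h) 0 1.
- exact: ltr01.
- by apply: dg; move: t01; rewrite in_itv /= => /andP[/ltW -> /ltW].
- apply: continuous_in_subspaceT => t; rewrite inE /= in_itv /= => t01.
  have gt := dg _ t01; apply: differentiable_continuous.
  by apply/derivable1_diffP; exact: (@ex_derive _ _ _ _ _ _ _ gt).
exists c; first by move: c01; rewrite in_itv.
by move: gc; rewrite /g scale1r scale0r addr0 subr0 mulr1.
Qed.

(** The C2 hypothesis bears on the directional derivatives, and the estimates on the
differential; this formula relates them. *)
Lemma diff_row_sum (R : realType) n (W : normedModType R) (f : 'rV[R]_n.+1 -> W) x h :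
  differentiable f x -> 'd f x h = \sum_i h ord0 i *: 'D_(delta_mx ord0 i) f x.
Proof.
move=> df; rewrite {1}(row_sum_delta h) linear_sum; apply: eq_bigr => i _.
by rewrite linearZ /= deriveE.
Qed.

Lemma ball_segment (R : realType) (V : normedModType R) (a x h : V) r t :
  ball a r x -> ball a r (x + h) -> 0 <= t <= 1 -> ball a r (x + t *: h).
Proof.
rewrite -!ball_normE /= => ax ay /andP[t0 t1].
have -> : a - (x + t *: h) = (1 - t) *: (a - x) + t *: (a - (x + h)).
  rewrite !opprD !addrA (scalerBr _ (a - x)) scalerBl scale1r addrA.
  by rewrite subrK.
apply: le_lt_trans (ler_normD _ _) _; rewrite !normrZ !ger0_norm ?subr_ge0 //.
have [->|tn] := eqVneq t 1; first by rewrite subrr mul0r add0r mul1r.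
have : (1 - t) * `|a - x| < (1 - t) * r by rewrite ltr_pM2l // subr_gt0 lt_neqAle tn.
have : t * `|a - (x + h)| <= t * r by rewrite ler_wpM2l // ltW.
lra.
Qed.

(** The partial derivatives are bounded near a by continuity, hence so is the
differential, and the mean value theorem applies to each coordinate on the
segments of a ball. *)
Lemma C1_lipschitz (R : realType) n k (U : set 'rV[R]_n.+1)
    (f : 'rV[R]_n.+1 -> 'rV[R]_k.+1) a :
  open U -> C1_on U f -> U a ->
  exists2 C, 0 <= C & \forall r \near 0^'+, forall x y, ball a r x -> ball a r y ->
    `|f y - f x| <= C * `|y - x|.
Proof.
move=> oU [df cdf] Ua.
pose D i := `|'D_(delta_mx ord0 i) f a| + 1.
have D0 i : 0 <= D i by rewrite addr_ge0.
exists (\sum_i D i); first by apply: sumr_ge0 => i _.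
have UE : \forall z \near a, U z by exact: open_nbhs_nbhs.
have DE : \forall z \near a, forall i, `|'D_(delta_mx ord0 i) f z| <= D i.
  apply: (@filter_forall _ _ _ _ (nbhs_filter a)) => i.
  have ci := cdf (delta_mx ord0 i) a Ua.
  by apply: (@cvgr_norm_le _ _ _ _ (nbhs_filter a) _ _ ci); rewrite /D ltrDl.
have [e /= e0 he] : nbhs_ball a [set z | U z /\ forall i, `|'D_(delta_mx ord0 i) f z| <= D i].
  by apply/nbhs_ballP; apply: filterI UE DE.
near=> r => x y ax ay.
have re : r <= e by near: r; exact: nbhs_right_le.
have seg t : 0 <= t <= 1 -> ball a e (x + t *: (y - x)).
  by move=> t01; apply: le_ball re _ _; apply: ball_segment; rewrite // addrC subrK.
have bnd z : ball a e z -> `|'d f z (y - x)| <= (\sum_i D i) * `|y - x|.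
  move=> /he[Uz hz]; rewrite diff_row_sum; last exact: df.
  apply: le_trans (ler_norm_sum _ _ _) _; rewrite mulr_suml; apply: ler_sum => i _.
  by rewrite normrZ mulrC ler_pM // coord_le_norm.
rewrite [X in X <= _]mx_normrE; apply: bigmax_le => [|[i j] _ /=].
  by rewrite mulr_ge0 // sumr_ge0.
rewrite ord1 !mxE !coord_dot.
have [t t01|c c01] := @segment_MVT _ _ (fun z => dot (f z) (delta_mx ord0 j)) x (y - x).
  apply: differentiable_dot; apply: df.
  by have [] := he _ (seg t t01).
have c01' : 0 <= c <= 1 by case/andP: c01 => /ltW -> /ltW.
rewrite [x + (y - x)]addrC subrK => ->.
have dfc : differentiable f (x + c *: (y - x)) by apply: df; have [] := he _ (seg c c01').
rewrite diff_dot // -coord_dot; apply: le_trans (coord_le_norm _ _) _.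
exact/bnd/seg.
Unshelve. all: by end_near. Qed.

Lemma ball_near_right (R : realType) (V : normedModType R) (a : V) (U : set V) :
  nbhs a U -> \forall r \near 0^'+, ball a r `<=` U.
Proof.
move=> /nbhs_ballP[e /= e0 eU]; near=> r; apply: subset_trans eU.
by apply: le_ball; near: r; exact: nbhs_right_le.
Unshelve. all: by end_near. Qed.

Lemma diff_sub_le (R : realType) n (W : normedModType R) (f : 'rV[R]_n.+1 -> W)
    x z h (C : 'I_n.+1 -> R) :
  differentiable f z -> differentiable f x ->
  (forall i, `|'D_(delta_mx ord0 i) f z - 'D_(delta_mx ord0 i) f x| <= C i) ->
  `|'d f z h - 'd f x h| <= (\sum_i C i) * `|h|.
Proof.
move=> dz dx hC.
have -> : 'd f z h - 'd f x h = \sum_i h ord0 i *: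
    ('D_(delta_mx ord0 i) f z - 'D_(delta_mx ord0 i) f x).
  apply: etrans (congr2 (fun a b => a - b) (diff_row_sum h dz) (diff_row_sum h dx)) _.
  by rewrite -sumrB; apply: eq_bigr => i _; rewrite scalerBr.
apply: le_trans (ler_norm_sum _ _ _) _; rewrite mulr_suml.
apply: ler_sum => i _; rewrite normrZ mulrC.
by rewrite ler_pM // coord_le_norm.
Qed.

(** By the mean value theorem each coordinate of f y - f x is that of the differential
at an intermediate point applied to y - x, and the differential is Lipschitz. *)
Lemma C2_taylor (R : realType) n k (U : set 'rV[R]_n.+1)
    (f : 'rV[R]_n.+1 -> 'rV[R]_k.+1) a :
  open U -> C2_on U f -> U a ->
  exists2 C, 0 <= C & \forall r \near 0^'+, forall x y, ball a r x -> ball a r y ->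
    `|f y - f x - 'd f x (y - x)| <= C * `|y - x| ^+ 2.
Proof.
move=> oU [[df _] c1] Ua.
have /fin_all_exists2[C C0 hC] : forall i : 'I_n.+1, exists2 C, 0 <= C &
    \forall r \near 0^'+, forall x y, ball a r x -> ball a r y ->
    `|'D_(delta_mx ord0 i) f y - 'D_(delta_mx ord0 i) f x| <= C * `|y - x|.
  by move=> i; exact: C1_lipschitz (c1 _) Ua.
exists (\sum_i C i); first by apply: sumr_ge0 => i _.
have hCr : \forall r \near 0^'+, forall i x y, ball a r x -> ball a r y ->
    `|'D_(delta_mx ord0 i) f y - 'D_(delta_mx ord0 i) f x| <= C i * `|y - x|.
  exact: filter_forall.
have rUr : \forall r \near 0^'+, ball a r `<=` U.
  by apply: ball_near_right; exact: open_nbhs_nbhs.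
near=> r => x y ax ay.
have rU : ball a r `<=` U by near: r.
have hCi : forall i x y, ball a r x -> ball a r y ->
    `|'D_(delta_mx ord0 i) f y - 'D_(delta_mx ord0 i) f x| <= C i * `|y - x|.
  by near: r.
have seg t : 0 <= t <= 1 -> ball a r (x + t *: (y - x)).
  by move=> t01; apply: ball_segment; rewrite // addrC subrK.
rewrite [X in X <= _]mx_normrE; apply: bigmax_le => [|[i j] _ /=].
  by rewrite mulr_ge0 // sumr_ge0.
rewrite ord1 !mxE !coord_dot.
have [t t01|c c01] := @segment_MVT _ _ (fun z => dot (f z) (delta_mx ord0 j)) x (y - x).
  by apply: differentiable_dot; apply/df/rU/seg.
have c01' : 0 <= c <= 1 by case/andP: c01 => /ltW -> /ltW.
rewrite [x + (y - x)]addrC subrK => ->.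
have dfc : differentiable f (x + c *: (y - x)) by apply/df/rU/seg.
rewrite diff_dot // -dotBl -coord_dot; apply: le_trans (coord_le_norm _ _) _.
apply: le_trans (diff_sub_le _ dfc (df _ (rU _ ax))
  (fun l => hCi l _ _ ax (seg c c01'))) _.
rewrite -mulr_suml -mulrA ler_wpM2l ?sumr_ge0 // expr2 ler_wpM2r //.
rewrite [X in X - x]addrC addrK normrZ ler_piMl //.
by rewrite ger0_norm; case/andP: c01'.
Unshelve. all: by end_near. Qed.

(** * Derivatives and inequalities *)

Lemma near_ray (R : realType) (V : normedModType R) (x v : V) (U : set V) :
  (\forall y \near x, U y) -> \forall t \near (0 : R)^'+, U (x + t *: v).
Proof.
move=> /nbhs_ballP[r /= r0 rU]; have v1 : 0 < `|v| + 1 by rewrite ltr_wpDl.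
near=> t; apply: rU; have t0 : 0 < t by near: t; exact: nbhs_right_gt.
rewrite -ball_normE /= opprD addNKr normrN normrZ gtr0_norm //.
apply: (@le_lt_trans _ _ (t * (`|v| + 1))).
  by rewrite ler_wpM2l ?(ltW t0) // lerDl.
by rewrite -ltr_pdivlMr //; near: t; apply: nbhs_right_lt; rewrite divr_gt0.
Unshelve. all: by end_near. Qed.

(** First order necessary condition at a one-sided minimum; an error of second
order is allowed since it does not affect the derivative. *)
Lemma diff_ge0 (R : realType) (V : normedModType R) (f : V -> R) x v M :
  differentiable f x ->
  (\forall t \near (0 : R)^'+, f x - M * t ^+ 2 <= f (x + t *: v)) -> 0 <= 'd f x v.
Proof.
move=> df fv; rewrite leNgt; apply/negP => dv.
have [e e0 de] : exists2 e, 0 < e & 'd f x v = - (2 * e).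
  by exists (- 'd f x v / 2); [rewrite divr_gt0 ?oppr_gt0|field].
have v1 : 0 < `|v| + 1 by rewrite ltr_wpDl.
have M1 : 0 < 2 * (`|M| + 1) by rewrite mulr_gt0 // ltr_wpDl.
have e'0 : 0 < e / (`|v| + 1) by rewrite divr_gt0.
near (0 : R)^'+ => t.
have t0 : 0 < t by near: t; exact: nbhs_right_gt.
have tM : t <= e / (2 * (`|M| + 1)).
  by near: t; apply: nbhs_right_le; rewrite divr_gt0.
have ft : f x - M * t ^+ 2 <= f (x + t *: v) by near: t.
have : `|f (x + t *: v) - f x - 'd f x (x + t *: v - x)| <=
    e / (`|v| + 1) * `|x + t *: v - x|.
  by near: t; exact: near_ray (differentiable_approx df e'0).
rewrite [x + _ - x]addrC addKr normrZ gtr0_norm // linearZ /=.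
rewrite ler_norml => /andP[_].
have ev : e / (`|v| + 1) * (t * `|v|) <= e * t.
  rewrite mulrAC ler_pdivrMr // -mulrA ler_wpM2l ?(ltW e0) //.
  by rewrite mulrDr mulr1 lerDl ltW.
have Mt : M * t ^+ 2 <= e / 2 * t.
  apply: (@le_trans _ _ (`|M| * t ^+ 2)).
    by rewrite ler_wpM2r ?sqr_ge0 // ler_norm.
  rewrite expr2 mulrA ler_wpM2r ?(ltW t0) //.
  move: tM; rewrite ler_pdivlMr // => tM.
  have := normr_ge0 M; nra.
rewrite -[_ *: 'd f x v]/(t * _) de.
have := mulr_gt0 e0 t0; nra.
Unshelve. all: by end_near. Qed.

Lemma near_eq_diff (R : realType) (V W : normedModType R) (f g : V -> W) x :
  (\forall y \near x, f y = g y) -> differentiable f x ->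
  differentiable g x /\ 'd g x = 'd f x :> (V -> W).
Proof.
move=> fg df; have [] // : is_diff x g ('d f x).
apply: approx_is_diff; first exact: diff_continuous.
move=> e e0; have fgx := nbhs_singleton fg.
apply: filterS2 fg (differentiable_approx df e0) => y <-.
by rewrite -fgx.
Qed.

(** * Nearest points of a hypersurface with boundary *)

Definition nearest (R : realType) n (Gamma : set 'rV[R]_n) (x p : 'rV[R]_n) :=
  Gamma p /\ forall y, Gamma y -> enorm (p - x) <= enorm (y - x).

Definition convex_in_rV (R : realType) n (C : set 'rV[R]_n) :=
  forall a b t, C a -> C b -> 0 <= t <= 1 -> C (a + t *: (b - a)).

(** Expand |(y - p) - (x - p)|^2. *)
Lemma ler_enormB_dot (R : realType) n (x p y : 'rV[R]_n) :
  (enorm (p - x) <= enorm (y - x)) =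
  (2 * dot (x - p) (y - p) <= dot (y - p) (y - p)).
Proof.
rewrite ler_enorm -[y - x](subrKA p) -(opprB x p) !dotE.
rewrite -subr_ge0 -[RHS]subr_ge0; congr (0 <= _).
rewrite !(dotC _ x) !(dotC _ p); ring.
Qed.

(** The distance to x along the curve t |-> Psi (a + t h), which starts at the nearest
point, cannot decrease to first order. *)
Lemma nearest_tangent (R : realType) n k (Gamma : set 'rV[R]_k.+1)
    (Psi : 'rV[R]_n.+1 -> 'rV[R]_k.+1) x a h :
  differentiable Psi a -> nearest Gamma x (Psi a) ->
  (\forall t \near (0 : R)^'+, Gamma (Psi (a + t *: h))) ->
  dot (x - Psi a) ('d Psi a h) <= 0.
Proof.
move=> dPsi [_ pmin] Gh; pose N : R := k.+1%:R.
pose C := N * (`|'d Psi a h| + `|h|).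
have C0 : 0 <= C by rewrite mulr_ge0 // addr_ge0.
have near_C : \forall z \near a, enorm (Psi z - Psi a) <= N * (`|'d Psi a (z - a)| + `|z - a|).
  apply: filterS (differentiable_approx dPsi ltr01) => z; rewrite mul1r => hz.
  apply: le_trans (enorm_le_norm _) _; rewrite ler_wpM2l //.
  rewrite -[Psi z - Psi a](subrK ('d Psi a (z - a))).
  by apply: le_trans (ler_normD _ _) _; rewrite addrC lerD2l.
suff : 0 <= 'd (fun z => dot (Psi z) (Psi a - x)) a h.
  rewrite (_ : 'd _ _ _ = dot ('d Psi a h) (Psi a - x)); last exact: diff_dot.
  by rewrite dotC -opprB dotNl oppr_ge0.
apply: (@diff_ge0 _ _ _ _ _ (2^-1 * C ^+ 2)); first exact: differentiable_dot.
near=> t; have t0 : 0 < t by near: t; exact: nbhs_right_gt.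
have Gt : Gamma (Psi (a + t *: h)) by near: t.
have : enorm (Psi (a + t *: h) - Psi a) <= C * t.
  have : enorm (Psi (a + t *: h) - Psi a) <=
      N * (`|'d Psi a (a + t *: h - a)| + `|a + t *: h - a|).
    by near: t; exact: near_ray near_C.
  rewrite [a + _ - a]addrC addKr linearZ !normrZ gtr0_norm // -mulrDr.
  by rewrite mulrCA mulrC.
have := pmin _ Gt; rewrite ler_enormB_dot -enorm_sqr.
move: (enorm _) (enorm_ge0 (Psi (a + t *: h) - Psi a)) => e e0 h1 eC.
have e2 : e ^+ 2 <= (C * t) ^+ 2.
  by rewrite ler_sqr ?nnegrE // mulr_ge0 // ltW.
rewrite lerBlDr -lerBlDl -dotBl dotC -opprB dotNl -dotNr opprB.
by move: e2; rewrite exprMn; lra.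
Unshelve. all: by end_near. Qed.

(** The curve Psi (Phi p + t (Phi q - Phi p)) stays in Gamma by convexity of C. Its
initial velocity v satisfies <x - p, v> <= 0, and q - p = v + w where w is
bounded by a multiple of |Phi q - Phi p|^2, hence of |q - p|^2. *)
Lemma chart_normal_bound (R : realType) n (Gamma U V C : set 'rV[R]_n.+1) Phi Psi p0 :
  C2_diffeomorphism U V Phi Psi -> U p0 ->
  (forall x, U x -> (Gamma x <-> C (Phi x))) -> convex_in_rV C ->
  exists2 K, 0 <= K & \forall r \near 0^'+, forall p q x,
    ball p0 r p -> ball p0 r q -> nearest Gamma x p -> Gamma q ->
    dot (x - p) (q - p) <= K * (enorm (x - p) * enorm (q - p) ^+ 2).
Proof.
move=> [[oU oV [c1Phi _] c2Psi] [UV VU PhiK PsiK]] Up0 GC segC.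
have [T T0 hT] := C2_taylor oV c2Psi (UV _ Up0).
have [L L0 hL] := C1_lipschitz oU c1Phi Up0.
have sV : \forall s \near 0^'+, ball (Phi p0) s `<=` V.
  by apply: ball_near_right; apply: open_nbhs_nbhs; split=> //; exact: UV.
have [s [s0 {hT}hT {}sV]] : exists s, [/\ 0 < s,
    forall x y, ball (Phi p0) s x -> ball (Phi p0) s y ->
      `|Psi y - Psi x - 'd Psi x (y - x)| <= T * `|y - x| ^+ 2
    & ball (Phi p0) s `<=` V].
  near (0:R)^'+ => s; exists s.
  split; [by near: s; exact: nbhs_right_gt|by near: s|by near: s].
have rU : \forall r \near 0^'+, ball p0 r `<=` U.
  by apply: ball_near_right; exact: open_nbhs_nbhs.
have rS : \forall r \near 0^'+, ball p0 r `<=` Phi @^-1` ball (Phi p0) s.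
  apply: ball_near_right; have /differentiable_continuous cP := c1Phi.1 _ Up0.
  by apply: cP; exact: nbhsx_ballx.
pose N : R := n.+1%:R.
exists (N * T * L ^+ 2); first by rewrite !mulr_ge0.
near=> r => p q x bp bq [Gp pmin] Gq.
have bU : ball p0 r `<=` U by near: r.
have bS : ball p0 r `<=` Phi @^-1` ball (Phi p0) s by near: r.
have Lip : forall x y, ball p0 r x -> ball p0 r y -> `|Phi y - Phi x| <= L * `|y - x|.
  by near: r.
have [Up Uq] := (bU _ bp, bU _ bq).
pose a := Phi p; pose h := Phi q - a; pose c t := Psi (a + t *: h).
pose v := 'd Psi a h.
have ah : a + h = Phi q by rewrite /h addrC subrK.
have seg t : 0 <= t <= 1 -> ball (Phi p0) s (a + t *: h).
  by move=> t01; apply: ball_segment => //; rewrite ?ah; exact: bS.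
have Gc t : 0 <= t <= 1 -> Gamma (c t).
  move=> t01; have Vt := sV _ (seg t t01).
  by apply/GC; [exact: VU|rewrite PsiK //; apply: segC => //; apply/GC].
pose E := N * (T * `|h| ^+ 2).
have v0 : dot (x - p) v <= 0.
  have pE : Psi a = p by exact: PhiK.
  rewrite -pE; apply: (@nearest_tangent _ _ _ Gamma); rewrite ?pE //.
    by apply: c2Psi.1.1; exact: UV.
  near=> t; apply: Gc; apply/andP.
  by split; [apply: ltW|]; near: t; [exact: nbhs_right_gt|exact: nbhs_right_le].
have [w qp wE] : exists2 w, q - p = v + w & enorm w <= E.
  exists (q - p - v); first by rewrite [RHS]addrC subrK.
  apply: le_trans (enorm_le_norm _) _; rewrite ler_wpM2l //.
  by have := hT _ _ (bS _ bp) (bS _ bq); rewrite !PhiK.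
rewrite qp dotDr.
have hE : `|h| <= L * enorm (v + w).
  rewrite -qp; apply: le_trans (Lip _ _ bp bq) _.
  by rewrite ler_wpM2l // norm_le_enorm.
have {}hE : `|h| ^+ 2 <= L ^+ 2 * enorm (v + w) ^+ 2.
  by rewrite -exprMn ler_sqr ?nnegrE // mulr_ge0 // enorm_ge0.
have EE : E <= N * T * L ^+ 2 * enorm (v + w) ^+ 2.
  by rewrite /E mulrA -[leRHS]mulrA ler_wpM2l // mulr_ge0.
have := dot_cauchy_schwarz (x - p) w; have := enorm_ge0 (x - p).
have := ler_wpM2l (enorm_ge0 (x - p)) (le_trans wE EE).
lra.
Unshelve. all: by end_near. Qed.

Lemma hypersurface_chart (R : realType) m (Gamma : set 'rV[R]_m.+1) p :
  (hypersurface_interior Gamma `|` hypersurface_boundary Gamma) p ->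
  exists U V Phi Psi C, [/\ C2_diffeomorphism U V Phi Psi, U p,
    forall x, U x -> (Gamma x <-> C (Phi x)) & convex_in_rV C].
Proof.
move=> [[_ [U [V [Phi [Psi [dP Up GU]]]]]]|[_ [U [V [Phi [Psi [dP Up _ GU]]]]]]].
  exists U, V, Phi, Psi, [set y | y ord0 ord_max = 0]; split=> // a b t /= a0 b0 _.
  by rewrite !mxE a0 b0 subrr mulr0 addr0.
exists U, V, Phi, Psi, [set y | y ord0 ord_max = 0 /\ 0 <= y ord0 ord0].
split=> // a b t /= [a0 a1] [b0 b1] /andP[t0 t1].
rewrite !mxE a0 b0 subrr mulr0 addr0; split=> //.
have -> : a ord0 ord0 + t * (b ord0 ord0 - a ord0 ord0) =
  (1 - t) * a ord0 ord0 + t * b ord0 ord0 by ring.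
by rewrite addr_ge0 // mulr_ge0 // subr_ge0.
Qed.

(** Near the diagonal the charts give the inequality, uniformly by compactness; when
|q - p| is bounded below, Cauchy-Schwarz gives it for K large. *)
Lemma normal_bound (R : realType) m (Gamma : set 'rV[R]_m.+1) :
  compact_C2_hypersurface Gamma ->
  exists2 K, 0 < K & forall p q x, nearest Gamma x p -> Gamma q ->
    dot (x - p) (q - p) <= K * (enorm (x - p) * enorm (q - p) ^+ 2).
Proof.
move=> [/compact_near_coveringP cG GIB].
pose bound (K : R) p := forall q x, nearest Gamma x p -> Gamma q ->
    dot (x - p) (q - p) <= K * (enorm (x - p) * enorm (q - p) ^+ 2).
suff : \forall K \near +oo, Gamma `<=` bound K.
  move=> h; near (@pinfty_nbhs R) => K; exists K.
    by near: K; exact: nbhs_pinfty_gt.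
  move=> p q x xp Gq; have GK : Gamma `<=` bound K by near: K.
  by apply: GK => //; case: xp.
apply: cG => p0 /GIB/hypersurface_chart[U [V [Phi [Psi [C [dP Up GC sC]]]]]].
have [K K0 hK] := chart_normal_bound dP Up GC sC.
have [r [r0 {}hK]] : exists r, 0 < r /\ forall p q x,
    ball p0 r p -> ball p0 r q -> nearest Gamma x p -> Gamma q ->
    dot (x - p) (q - p) <= K * (enorm (x - p) * enorm (q - p) ^+ 2).
  near (0:R)^'+ => r; exists r.
  by split; near: r; first exact: nbhs_right_gt.
have r2 : 0 < r / 2 by rewrite divr_gt0.
exists (ball p0 (r / 2), [set K' | Num.max K (r / 2)^-1 <= K']).
  by split; [exact: nbhsx_ballx|apply: nbhs_pinfty_ge; exact: num_real].
move=> [p K'] /= [bp]; rewrite ge_max => /andP[KK' rK'] q x xp Gq.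
(* For q near p both points lie in the ball of the chart; else 1 / K' is at most
   the distance from p to q. *)
have [bq|bq] := pselect (ball p (r / 2) q).
  apply: le_trans (hK p q x _ _ xp Gq) _.
  - by apply: le_ball bp; lra.
  - by rewrite [r]splitr; apply: ball_triangle bp bq.
  by rewrite ler_wpM2r ?mulr_ge0 ?enorm_ge0 ?sqr_ge0.
have rq : r / 2 <= enorm (q - p).
  apply: le_trans (norm_le_enorm _); rewrite leNgt; apply/negP => h; apply: bq.
  by rewrite -ball_normE /= distrC.
apply: le_trans (dot_cauchy_schwarz _ _) _; rewrite mulrCA ler_wpM2l ?enorm_ge0 //.
rewrite expr2 mulrA ler_peMl ?enorm_ge0 //.
by rewrite -(mulVf (lt0r_neq0 r2)) ler_pM // ?invr_ge0 ltW.
Unshelve. all: by end_near. Qed.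

(** * The closest point mapping in a tube around the hypersurface *)

Section Projection.
Variables (R : realType) (m : nat) (Gamma : set 'rV[R]_m.+1).
Variables (P : 'rV[R]_m.+1 -> 'rV[R]_m.+1) (K : R).
Hypothesis PG : closest_point_map Gamma P.
Hypothesis K0 : 0 < K.
Hypothesis PK : forall p q x, nearest Gamma x p -> Gamma q ->
  dot (x - p) (q - p) <= K * (enorm (x - p) * enorm (q - p) ^+ 2).

Local Notation rho x := (enorm (x - P x)).

Definition tube : set 'rV[R]_m.+1 := [set x | 4 * K * rho x < 1].

Lemma nearest_dot x q : Gamma q -> 2 * dot (x - P x) (q - P x) <= dot (q - P x) (q - P x).
Proof. by move=> Gq; rewrite -ler_enormB_dot; exact: (PG x).2. Qed.

Lemma proj_id x : Gamma x -> P x = x.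
Proof.
move=> /(PG x).2; rewrite subrr => h; apply/eqP; rewrite -subr_eq0 -enorm_eq0.
have := enorm_ge0 (P x - x); move: h.
by rewrite (_ : enorm 0 = 0); [lra|apply/eqP; rewrite enorm_eq0].
Qed.

(** Add the inequalities of [nearest_dot] for the pairs (x, P y) and (y, P x). *)
Lemma proj_monotone x y : 0 <= dot (P x - P y) (x - y).
Proof.
have := nearest_dot x (PG y).1; have := nearest_dot y (PG x).1.
rewrite !dotE !(dotC _ (P y)) !(dotC _ (P x)) (dotC (P x) (P y)); lra.
Qed.

Lemma rho_lipschitz x y : rho x - rho y <= enorm (x - y).
Proof.
rewrite lerBlDr; have := (PG x).2 _ (PG y).1; rewrite !(enormB _ x) => h.
apply: le_trans h _; rewrite -[x - P y](subrKA y); exact: enorm_triangle.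
Qed.

(** Adding [PK] for (x, P y) and (y, P x) gives |e|^2 - <x - y, e> <= |e|^2 / 2 for
e = P x - P y. *)
Lemma proj_lipschitz x y : tube x -> tube y -> enorm (P x - P y) <= 2 * enorm (x - y).
Proof.
rewrite /tube /= => tx ty.
have := PK (PG x) (PG y).1; have := PK (PG y) (PG x).1.
rewrite (enormB (P y)); set e := enorm (P x - P y) => h1 h2.
have e2 : e ^+ 2 = dot (P x - P y) (P x - P y) by rewrite enorm_sqr.
have h3 : dot (x - P x) (P y - P x) + dot (y - P y) (P x - P y) =
    e ^+ 2 - dot (x - y) (P x - P y) by rewrite e2 !dotE; ring.
have := dot_cauchy_schwarz (x - y) (P x - P y); rewrite -/e => h4.
have e0 : 0 <= e by exact: enorm_ge0.
have h5 : K * (rho x * e ^+ 2) <= 4^-1 * e ^+ 2.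
  by rewrite mulrA ler_wpM2r ?sqr_ge0 //; lra.
have h6 : K * (rho y * e ^+ 2) <= 4^-1 * e ^+ 2.
  by rewrite mulrA ler_wpM2r ?sqr_ge0 //; lra.
have h7 : e * e <= (2 * enorm (x - y)) * e by rewrite -expr2; lra.
have [e00|en0] := eqVneq e 0; first by rewrite e00 mulr_ge0 // enorm_ge0.
by rewrite -(@ler_pM2r _ e) // lt_neqAle eq_sym en0.
Qed.

(** The upper bound comes from |y - P y| <= |y - P x|; the lower one from exchanging
x and y, at the cost of the variation of P, which is Lipschitz. *)
Lemma rho_sqr_expand x y : tube x -> tube y ->
  `|rho y ^+ 2 - rho x ^+ 2 - 2 * dot (x - P x) (y - x)| <= 3 * enorm (y - x) ^+ 2.
Proof.
move=> tx ty.
have h1 : rho y ^+ 2 <= enorm (y - P x) ^+ 2.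
  rewrite ler_sqr ?nnegrE ?enorm_ge0 // !(enormB y); exact: ((PG y).2 _ (PG x).1).
have h2 : rho x ^+ 2 <= enorm (x - P y) ^+ 2.
  rewrite ler_sqr ?nnegrE ?enorm_ge0 // !(enormB x); exact: ((PG x).2 _ (PG y).1).
have h3 := proj_lipschitz ty tx.
have h4 := dot_cauchy_schwarz (P y - P x) (y - x).
have h5 : dot (P y - P x) (y - x) <= 2 * enorm (y - x) ^+ 2.
  by apply: le_trans h4 _; rewrite expr2 mulrA ler_wpM2r ?enorm_ge0.
move: h1 h2 h5; rewrite !enorm_sqr ler_norml.
have -> : y - P x = (y - x) + (x - P x) by rewrite addrA subrK.
have -> : x - P y = (x - P x) - (P y - P x) by apply/rowP => i; rewrite !mxE; ring.
have -> : y - P y = (y - x) + (x - P x) - (P y - P x).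
  by apply/rowP => i; rewrite !mxE; ring.
move: (y - x) (x - P x) (P y - P x) => a b c.
rewrite !dotE (dotC b a) (dotC c a) (dotC c b) => h1 h2 h5.
by apply/andP; split; lra.
Qed.

Lemma tube_near x : tube x -> \forall y \near x, tube y.
Proof.
rewrite /tube /= => tx; have e0 : 0 < (1 - 4 * K * rho x) / (4 * K * m.+2%:R).
  by rewrite divr_gt0 ?mulr_gt0 // subr_gt0.
apply/nbhs_ballP; exists ((1 - 4 * K * rho x) / (4 * K * m.+2%:R)) => //= y.
rewrite -ball_normE /= ltr_pdivlMr ?mulr_gt0 // => xy.
have := rho_lipschitz y x; have := enorm_le_norm (y - x); rewrite distrC in xy.
have := normr_ge0 (y - x); have m1 : m.+1%:R + 1 = m.+2%:R :> R by rewrite natr1.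
rewrite -m1 in xy; move: (`|y - x|) (rho y) (rho x) xy => a b c xy a0 h1 h2.
have h3 : b - c <= m.+1%:R * a by apply: le_trans h2 h1.
have h4 : 4 * K * (b - c) <= 4 * K * (m.+1%:R * a) by rewrite ler_wpM2l // mulr_ge0 // ltW.
have : 0 <= K * a by rewrite mulr_ge0 // ltW.
lra.
Qed.

Lemma proj_near_lipschitz x : tube x ->
  \forall y \near x, enorm (P y - P x) <= 2 * enorm (y - x).
Proof. by move=> tx; apply: filterS (tube_near tx) => y ty; exact: proj_lipschitz. Qed.

(** A ball centred on the segment from x to P x with P x on its boundary lies in the
ball of centre x through P x and touches its boundary at P x only. *)
Lemma proj_segment x t : 0 < t <= 1 -> P (x - t *: (x - P x)) = P x.
Proof.
move=> /andP[t0 t1]; set y := x - t *: _; set q := P y.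
have h1 := nearest_dot x (PG y).1; have h2 := (PG y).2 _ (PG x).1.
rewrite -/q in h1 h2; move: h2; rewrite ler_enorm.
have -> : q - y = (q - P x) - (1 - t) *: (x - P x).
  apply/rowP => i; rewrite /y !mxE; ring.
have -> : P x - y = - ((1 - t) *: (x - P x)).
  by apply/rowP => i; rewrite /y !mxE; ring.
move=> h2; apply/eqP; rewrite -subr_eq0 -dot_eq0; apply/eqP.
move: (q - P x) (x - P x) h1 h2 => z w h1; rewrite !dotE (dotC z w) => h2.
have z0 := dot_ge0 z; nra.
Qed.


Lemma diff_proj_monotone x v : differentiable P x -> 0 <= dot ('d P x v) v.
Proof.
move=> dP; rewrite -diff_dot //; apply: (@diff_ge0 _ _ _ _ _ 0).
  exact: differentiable_dot.
near=> t; have t0 : 0 < t by near: t; exact: nbhs_right_gt.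
rewrite mul0r subr0 -subr_ge0 -dotBl -(pmulr_rge0 _ t0) -dotZr.
have := proj_monotone (x + t *: v) x.
by rewrite [x + _ - x]addrC addKr.
Unshelve. all: by end_near. Qed.

(** P x maximizes <x - P x, .> on the image of P up to a second order error, since
P is Lipschitz; so the derivative of this linear form composed with P vanishes. *)
Lemma diff_proj_normal x v : tube x -> differentiable P x -> dot ('d P x v) (x - P x) = 0.
Proof.
move=> tx dP; suff h u : 0 <= dot ('d P x u) (- (x - P x)).
  have := h v; have := h (- v); rewrite linearN !dotE; lra.
rewrite -diff_dot //.
apply: (@diff_ge0 _ _ _ _ _ (2 * enorm u ^+ 2)); first exact: differentiable_dot.
near=> t; have t0 : 0 < t by near: t; exact: nbhs_right_gt.
have lip : enorm (P (x + t *: u) - P x) <= 2 * enorm ((x + t *: u) - x).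
  by near: t; exact: near_ray (proj_near_lipschitz tx).
have h1 := nearest_dot x (PG (x + t *: u)).1; rewrite -enorm_sqr in h1.
have h2 : enorm (P (x + t *: u) - P x) ^+ 2 <= (2 * (t * enorm u)) ^+ 2.
  rewrite ler_sqr ?nnegrE ?mulr_ge0 ?enorm_ge0 // ?(ltW t0) //.
  by move: lip; rewrite [x + _ - x]addrC addKr enormZ gtr0_norm.
rewrite lerBlDr -lerBlDl -dotBl dotNr -dotNl opprB dotC.
by move: h2; rewrite !exprMn; lra.
Unshelve. all: by end_near. Qed.

Lemma diff_proj_kernel x : differentiable P x -> 'd P x (x - P x) = 0.
Proof.
move=> dP; suff h g : 0 <= dot ('d P x (- (x - P x))) g.
  apply/eqP; rewrite -dot_eq0 eq_le -{1}oppr_ge0 dot_ge0 andbT -dotNl -linearN.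
  exact: h.
rewrite -diff_dot //; apply: (@diff_ge0 _ _ _ _ _ 0).
  exact: differentiable_dot.
near=> t; rewrite mul0r subr0 scalerN proj_segment //.
by apply/andP; split; near: t; [exact: nbhs_right_gt|exact: nbhs_right_le].
Unshelve. all: by end_near. Qed.

End Projection.

(** * The signed distance measures the distance to the boundary *)

Lemma distance_to_le (R : realType) n (A : set 'rV[R]_n) x y :
  A y -> distance_to A x <= enorm (x - y).
Proof.
move=> Ay; apply: ge_inf; last by exists y.
by exists 0 => _ [z _ <-]; exact: enorm_ge0.
Qed.

Lemma distance_to_ge (R : realType) n (A : set 'rV[R]_n) x c :
  A !=set0 -> (forall y, A y -> c <= enorm (x - y)) -> c <= distance_to A x.
Proof.
move=> [a Aa] h; apply: lb_le_inf; first by exists (enorm (x - a)), a.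
by move=> _ [z Az <-]; exact: h.
Qed.

(** Otherwise the points of [0, 1] whose image is in A form a subset that is both open
and closed. *)
Lemma segment_meets_boundary (R : realType) n (A : set 'rV[R]_n.+1) u z :
  open A -> A u -> ~ A z ->
  exists2 t, 0 <= t <= 1 & (closure A `\` A) (u + t *: (z - u)).
Proof.
move=> oA Au nAz; apply: contrapT => nb; apply: nAz.
pose f (t : R) : 'rV[R]_n.+1 := u + t *: (z - u).
have cf : continuous f.
  move=> t; apply: cvgD; first exact: cvg_cst.
  by apply: cvgZr_tmp; exact: cvg_id.
pose B := `[0, 1]%classic `&` f @^-1` A.
have BE : B = `[(0 : R), 1]%classic `&` f @^-1` closure A.
  apply/seteqP; split=> t [t01 ft]; split=> //=; first exact: subset_closure.
  apply: contrapT => nft; apply: nb; exists t => //.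
have B1 : B = `[(0 : R), 1]%classic.
  apply: (@segment_connected R 0 1).
  - by exists 0; split; rewrite /= ?in_itv /= ?lexx ?ler01 // /f scale0r addr0.
  - by exists (f @^-1` A) => //; apply: open_comp => // t _; exact: cf.
  - exists (f @^-1` closure A) => //; apply: preimage_closed => [t _|]; first exact: cf.
    exact: closed_closure.
have : B 1 by rewrite B1 /= in_itv /= ler01 lexx.
by case=> _; rewrite /= /f scale1r addrC subrK.
Qed.

Section DistanceFunction.
Variables (R : realType) (m : nat) (Gamma : set 'rV[R]_m.+1).
Variables (d : 'rV[R]_m.+1 -> R) (P : 'rV[R]_m.+1 -> 'rV[R]_m.+1).
Hypothesis dG : is_distance_function Gamma d.
Hypothesis PG : closest_point_map Gamma P.

Local Notation rho x := (enorm (x - P x)).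

Lemma rho_le x y : Gamma y -> rho x <= enorm (x - y).
Proof. by move=> Gy; rewrite !(enormB x); exact: (PG x).2. Qed.

Section Signed.
Variable Om : set 'rV[R]_m.+1.
Hypothesis Odom : domain Om.
Hypothesis OG : closure Om `\` interior Om = Gamma.

Let oO : open Om. Proof. by case: Odom. Qed.

Lemma boundaryE : closure Om `\` Om = Gamma.
Proof. by rewrite -OG (interior_id _).1. Qed.

Lemma signed_distance_in x : Om x -> signed_distance Om x = rho x.
Proof.
move=> Ox; rewrite /signed_distance mem_set //; apply/eqP; rewrite eq_le.
have [_ nPx] : (closure Om `\` Om) (P x) by rewrite boundaryE; exact: (PG x).1.
rewrite distance_to_le //=; apply: distance_to_ge; first by exists (P x).
move=> y nOy; have [t /andP[t0 t1]] := segment_meets_boundary oO Ox nOy.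
rewrite boundaryE => /(rho_le x) h; apply: le_trans h _.
rewrite opprD addNKr enormN enormZ ger0_norm // enormB.
by rewrite ler_piMl ?enorm_ge0.
Qed.

Lemma signed_distance_out x : ~ closure Om x -> signed_distance Om x = - rho x.
Proof.
move=> nCx; have nOx : ~ Om x by move=> Ox; apply: nCx; exact: subset_closure.
rewrite /signed_distance memNset // mem_set //; congr (- _).
have [_ _ O0] := Odom; apply/eqP; rewrite eq_le; apply/andP; split.
  apply/ler_addgt0Pr => e e0.
  have [cPx _] : (closure Om `\` Om) (P x) by rewrite boundaryE; exact: (PG x).1.
  have e1 : 0 < e / m.+1%:R by rewrite divr_gt0.
  have [y [Oy]] := cPx _ (nbhsx_ballx (P x) _ e1).
  rewrite -ball_normE /= ltr_pdivlMr // mulrC => /ltW ye.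
  apply: le_trans (distance_to_le x Oy) _; rewrite -(subrKA (P x)).
  apply: le_trans (enorm_triangle _ _) _; rewrite lerD2l.
  exact: le_trans (enorm_le_norm _) ye.
apply: distance_to_ge => // y Oy.
have [t /andP[t0 t1]] := segment_meets_boundary oO Oy nOx.
rewrite boundaryE => /(rho_le x) h; apply: le_trans h _.
have -> : x - (y + t *: (x - y)) = (1 - t) *: (x - y).
  by apply/rowP => i; rewrite !mxE; ring.
by rewrite enormZ ger0_norm ?subr_ge0 // ler_piMl ?enorm_ge0 // gerBl.
Qed.

Lemma signed_distance_on x : closure Om x -> ~ Om x ->
  signed_distance Om x = 0 /\ rho x = 0.
Proof.
move=> cx nOx; have Gx : Gamma x by rewrite -boundaryE.
split; first by rewrite /signed_distance memNset // memNset.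
by apply/eqP; rewrite (proj_id PG Gx) subrr enorm_eq0.
Qed.

End Signed.

(** A segment from a point of Om to its complement, or from a point outside the
closure to a point of Om, meets Gamma; so the distance to the other side is the
distance to Gamma. *)
Lemma normr_distance x : `|d x| = rho x.
Proof.
case: dG => [[_ [Om [Odom OG dE]]]|[_ ->]]; last first.
  have -> : distance_to Gamma x = rho x.
    apply/eqP; rewrite eq_le (distance_to_le x (PG x).1) /=.
    by apply: distance_to_ge; [exists (P x); exact: (PG x).1|exact: rho_le].
  by rewrite ger0_norm ?enorm_ge0.
rewrite dE; have [Ox|nOx] := pselect (Om x).
  by rewrite (signed_distance_in Odom OG) // ger0_norm ?enorm_ge0.
have [cx|ncx] := pselect (closure Om x).
  by have [-> ->] := signed_distance_on Odom OG cx nOx; rewrite normr0.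
by rewrite (signed_distance_out Odom OG) // normrN ger0_norm ?enorm_ge0.
Qed.

Lemma distance_sign y : d y != 0 -> \forall z \near y, 0 <= d z * d y.
Proof.
move=> dy; case: dG => [[_ [Om [Odom OG dE]]]|[_ dE]]; last first.
  have d0 z : 0 <= d z.
    rewrite dE; apply: distance_to_ge => [|w _]; last exact: enorm_ge0.
    by exists (P z); exact: (PG z).1.
  by apply/nbhs_ballP; exists 1 => //= z _; rewrite mulr_ge0.
have [oO _ _] := Odom.
have [Oy|nOy] := pselect (Om y).
  apply: filterS (open_nbhs_nbhs (conj oO Oy)) => z Oz.
  by rewrite !dE !(signed_distance_in Odom OG) // mulr_ge0 ?enorm_ge0.
have [cy|ncy] := pselect (closure Om y).
  by move: dy; rewrite dE (signed_distance_on Odom OG cy nOy).1 eqxx.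
have oC : open (~` closure Om) by apply: closed_openC; exact: closed_closure.
apply: filterS (open_nbhs_nbhs (conj oC ncy)) => z nCz.
by rewrite !dE !(signed_distance_out Odom OG) // mulrNN mulr_ge0 ?enorm_ge0.
Qed.

End DistanceFunction.

(** * Curvatures of the level sets of the distance function *)

(** The signed and the unsigned distance are treated together: only [dabs] and
[dsgn] are used. *)
Section GaussMap.
Variables (R : realType) (m : nat) (Gamma : set 'rV[R]_m.+1).
Variables (d : 'rV[R]_m.+1 -> R) (P : 'rV[R]_m.+1 -> 'rV[R]_m.+1) (K : R).
Hypothesis PG : closest_point_map Gamma P.
Hypothesis K0 : 0 < K.
Hypothesis PK : forall p q x, nearest Gamma x p -> Gamma q ->
  dot (x - p) (q - p) <= K * (enorm (x - p) * enorm (q - p) ^+ 2).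
Hypothesis dabs : forall x, `|d x| = enorm (x - P x).
Hypothesis dsgn : forall y, d y != 0 -> \forall z \near y, 0 <= d z * d y.

Local Notation rho x := (enorm (x - P x)).

(** Near y the sign of d is constant, so that d is rho up to a fixed sign. *)
Lemma distance_near_lipschitz y : d y != 0 ->
  \forall z \near y, `|d z - d y| <= enorm (z - y).
Proof.
move=> dy; apply: filterS (dsgn dy) => z dzy.
have h1 := rho_lipschitz PG z y; have h2 := rho_lipschitz PG y z.
rewrite (enormB y z) -!dabs in h1 h2.
have : `|d z - d y| = `| `|d z| - `|d y| |.
  move: dy dzy; rewrite neq_lt => /orP[dy|dy].
    rewrite nmulr_lge0 // => dz; rewrite (ler0_norm dz) (ltr0_norm dy).
    by rewrite -[LHS]normrN; congr (`|_|); ring.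
  by rewrite pmulr_lge0 // => dz; rewrite (ger0_norm dz) (gtr0_norm dy).
by move=> ->; rewrite ler_norml h1 andbT lerNl opprB.
Qed.

(** d^2 = rho^2 has the derivative 2 <y - P y, .> by [rho_sqr_expand], and
d z - d y is (d z ^ 2 - d y ^ 2) / (2 d y) up to (d z - d y)^2 / (2 d y), which
is of second order. *)
Lemma distance_is_diff y : tube P K y -> d y != 0 ->
  is_diff y d (dotl ((d y)^-1 *: (y - P y))).
Proof.
move=> ty dy; apply: approx_is_diff; first exact: linear_rV_continuous.
move=> e e0; pose N : R := m.+1%:R.
have dy0 : 0 < `|d y| by rewrite normr_gt0.
have N0 : 0 < N by rewrite ltr0n.
pose r := e * `|d y| / (2 * N ^+ 2).
have r0 : 0 < r by rewrite divr_gt0 ?mulr_gt0 ?exprn_gt0.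
have near_r : \forall z \near y, `|z - y| <= r.
  apply/nbhs_ballP; exists r => //= z; rewrite -ball_normE /= distrC.
  exact: ltW.
apply: filterS3 near_r (tube_near PG K0 ty) (distance_near_lipschitz dy).
move=> z zr tz lip; have ex := rho_sqr_expand PG PK ty tz.
have en := enorm_le_norm (z - y).
rewrite /= /dotl dotZr dotC.
move: ex; rewrite -!dabs -!normrX !(ger0_norm (sqr_ge0 _)).
move: (dot _ _) lip en zr => w; rewrite -/N.
move: (enorm _) (enorm_ge0 (z - y)) `|z - y| (normr_ge0 (z - y)).
move=> a a0 b b0 lip ab br h.
have lip2 : (d z - d y) ^+ 2 <= a ^+ 2.
  by rewrite -real_normK ?num_real // ler_sqr ?nnegrE.
have h2 : `|2 * d y * (d z - d y - (d y)^-1 * w)| <= 4 * a ^+ 2.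
  have -> : 2 * d y * (d z - d y - (d y)^-1 * w) =
     (d z ^+ 2 - d y ^+ 2 - 2 * w) - (d z - d y) ^+ 2 by field.
  apply: le_trans (ler_normB _ _) _; rewrite (ger0_norm (sqr_ge0 _)); lra.
rewrite -(@ler_pM2l _ (2 * `|d y|)) ?mulr_gt0 //.
move: h2; rewrite !normrM (ger0_norm (ler0n _ 2)) => /le_trans; apply.
have a2 : a ^+ 2 <= (N * b) ^+ 2 by rewrite ler_sqr ?nnegrE // mulr_ge0 // ltW.
apply: (@le_trans _ _ (4 * (N * b) ^+ 2)); first by rewrite ler_wpM2l.
move: br; rewrite /r ler_pdivlMr ?mulr_gt0 ?exprn_gt0 // => br.
have := ler_wpM2r b0 br; rewrite exprMn; lra.
Qed.

Lemma gradient_distance y : tube P K y -> d y != 0 ->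
  gradient d y = (d y)^-1 *: (y - P y).
Proof.
move=> ty dy; have dd := distance_is_diff ty dy.
apply/rowP => i; rewrite mxE deriveE // diff_val.
by rewrite /dotl dotC -coord_dot.
Qed.

Lemma gauss_map_distance y : tube P K y -> d y != 0 ->
  gauss_map d y = (d y)^-1 *: (y - P y).
Proof.
move=> ty dy; rewrite /gauss_map gradient_distance // enormZ normfV dabs mulVf.
  by rewrite invr1 scale1r.
by rewrite -dabs normr_eq0.
Qed.

Lemma gauss_map_near x : tube P K x -> d x != 0 ->
  \forall z \near x, gauss_map d z = (d z)^-1 *: (z - P z).
Proof.
move=> tx dx; have dd := distance_is_diff tx dx.
have cd : {for x, continuous d} by exact: differentiable_continuous.
have dz : \forall z \near x, d z != 0 by exact: (cvgr_neq0 _ cd dx).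
by apply: filterS2 (tube_near PG K0 tx) dz => z tz dz0; exact: gauss_map_distance.
Qed.

Lemma differentiable_rV (V : normedModType R) n (f : V -> 'rV[R]_n) x :
  (forall j, differentiable (fun z => f z ord0 j) x) -> differentiable f x.
Proof.
move=> df.
have -> : f = \sum_j (fun z => f z ord0 j *: (delta_mx ord0 j : 'rV[R]_n)).
  by apply/funext => z; rewrite fct_sumE [LHS]row_sum_delta.
by apply: differentiable_sum => j; apply: differentiableZl.
Qed.

(** The Gauss map is the quotient of z - P z by d z near x, and the differential of d
vanishes on the vectors orthogonal to x - P x. *)
Lemma gauss_map_diff x : tube P K x -> d x != 0 -> differentiable P x ->
  differentiable (gauss_map d) x /\
  forall v, dot v (x - P x) = 0 ->
    'd (gauss_map d) x v = (d x)^-1 *: (v - 'd P x v).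
Proof.
move=> tx dx dP; have dd := distance_is_diff tx dx.
have dIP : is_diff x (fun z => z - P z) (fun v => v - 'd P x v).
  by have dPx := differentiableP dP; exact: (is_diffB (is_diff_id x) dPx).
have dc g : differentiable (fun z => (d z)^-1 * dot (z - P z) g) x.
  by apply: differentiableM; [exact: differentiableV|exact: differentiable_dot].
have nG g : \forall z \near x, (d z)^-1 * dot (z - P z) g = dot (gauss_map d z) g.
  by apply: filterS (gauss_map_near tx dx) => z ->; rewrite dotZl.
(* The identity nG g passes to the differentials: coordinates of the Gauss map for
   dN, and an arbitrary g for the value. *)
have dN : differentiable (gauss_map d) x.
  apply: differentiable_rV => j.
  have -> : (fun z => gauss_map d z ord0 j) = (fun z => dot (gauss_map d z) (delta_mx ord0 j)).
    by apply/funext => z; rewrite coord_dot.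
  exact: (near_eq_diff (nG _) (dc _)).1.
split=> // v vn; apply/eqP; rewrite -subr_eq0 -dot_eq0; apply/eqP.
move: (X in dot _ X) => g; rewrite dotBl -(diff_dot _ _ dN).
rewrite (near_eq_diff (nG g) (dc g)).2.
have dV : differentiable (fun z => (d z)^-1) x by exact: differentiableV.
have dD : differentiable (fun z => dot (z - P z) g) x by exact: differentiable_dot.
have ddv : 'd d x v = 0.
  by rewrite diff_val /= /dotl dotZr vn mulr0.
have dVv : 'd (fun z => (d z)^-1) x v = 0.
  apply: etrans (congr1 (fun h => h v) (diffV (@ex_diff _ _ _ _ _ _ _ dd) dx)) _.
  by rewrite /= ddv scaler0.
have dDv : 'd (fun z => dot (z - P z) g) x v = dot (v - 'd P x v) g.
  apply: etrans (diff_dot g v (@ex_diff _ _ _ _ _ _ _ dIP)) _; congr (dot _ _).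
  exact: (congr1 (fun h => h v) (@diff_val _ _ _ _ _ _ _ dIP)).
apply/eqP; rewrite subr_eq0 dotZl; apply/eqP.
apply: etrans (congr1 (fun h => h v) (diffM dV dD)) _.
rewrite -[RHS]addr0; congr (_ + _).
  exact: (congr1 (fun t => (d x)^-1 * t) dDv).
exact: etrans (congr1 (fun t => dot (x - P x) g * t) dVv) (mulr0 _).
Qed.

End GaussMap.

(** * The Jacobian factor off the hypersurface *)

Lemma mul_jacobian (R : realType) n k (f : 'rV[R]_n.+1 -> 'rV[R]_k.+1) x v :
  v *m 'J f x = 'd f x v.
Proof. exact: mul_rV_lin1. Qed.

Lemma mulmx_tr_eq0 (R : realType) n k (A : 'M[R]_(k, n)) (u : 'rV[R]_n) :
  (forall v : 'rV[R]_k, dot (v *m A) u = 0) -> A *m u^T = 0.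
Proof.
move=> h; apply/row_matrixP => i; rewrite row_mul row0 rowE.
by apply/matrixP => a b; rewrite !ord1 -dot_mx h mxE.
Qed.

Lemma det_mx22 (F : comNzRingType) (A : 'M[F]_2) :
  \det A = A 0 0 * A 1 1 - A 0 1 * A 1 0.
Proof.
rewrite (expand_det_row _ ord0) !big_ord_recl big_ord0 /cofactor !det_mx11 !mxE /=.
have e1 : lift ord0 ord0 = 1 :> 'I_2 by apply: val_inj.
have e2 : lift (1 : 'I_2) ord0 = 0 :> 'I_2 by apply: val_inj.
by rewrite !e1 !e2 /bump /= expr0 expr1 mul1r mulN1r mulrN addr0.
Qed.

Lemma det_one_plus (R : realType) m r (S : 'M[R]_r) eta : m = 1%N \/ m = 2%N -> r = m ->
  \det (1%:M + eta *: S) =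
  if m == 1%N then 1 + eta * \tr S
  else 1 + 2 * eta * (m%:R^-1 * \tr S) + eta ^+ 2 * \det S.
Proof.
move=> m12 rm; move: S; rewrite {}rm.
case: m12 => -> S /=.
  by rewrite det_mx11 !mxE trace_mx11.
rewrite !det_mx22 /mxtrace !big_ord_recl big_ord0 !mxE.
have -> : lift ord0 ord0 = 1 :> 'I_2 by apply: val_inj.
by rewrite /= mulr1n mulr0n; field.
Qed.

Lemma prod_singular (R : realType) m (s : seq R) : m = 1%N \/ m = 2%N ->
  \prod_(i < m) s`_i = if m == 1%N then s`_0 else s`_0 * s`_1.
Proof. by case=> ->; rewrite !big_ord_recl big_ord0 mulr1. Qed.

(** Used with N the derivative of the Gauss map, A that of P, and B a basis of the
tangent space: then A = 1 + c S there, where S is the Weingarten map. *)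
Lemma restrict_affine (F : fieldType) r n (B : 'M[F]_(r, n)) (N A : 'M[F]_n) c :
  c != 0 -> (B *m A <= B)%MS -> B *m N = c^-1 *: (B - B *m A) ->
  B *m A = (1%:M + c *: conjmx B (- N)) *m B.
Proof.
move=> c0 BAB BN.
have BNN : B *m (- N) = c^-1 *: (B *m A - B) by rewrite mulmxN BN -scalerN opprB.
rewrite /conjmx BNN mulmxDl mul1mx -scalemxAl mulmxKpV; last first.
  by rewrite scalemx_sub // addmx_sub // eqmx_opp.
by rewrite scalerA mulfV // scale1r [RHS]addrC subrK.
Qed.

Section JacobianFactor.
Variables (R : realType) (m : nat) (Gamma : set 'rV[R]_m.+1).
Variables (d : 'rV[R]_m.+1 -> R) (P : 'rV[R]_m.+1 -> 'rV[R]_m.+1) (K : R).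
Hypothesis PG : closest_point_map Gamma P.
Hypothesis K0 : 0 < K.
Hypothesis PK : forall p q x, nearest Gamma x p -> Gamma q ->
  dot (x - p) (q - p) <= K * (enorm (x - p) * enorm (q - p) ^+ 2).
Hypothesis dabs : forall x, `|d x| = enorm (x - P x).
Hypothesis dsgn : forall y, d y != 0 -> \forall z \near y, 0 <= d z * d y.

Lemma jacobian_ge0 x (v : 'rV[R]_m.+1) : differentiable P x -> 0 <= (v *m 'J P x *m v^T) 0 0.
Proof. by move=> dP; rewrite -dot_mx mul_jacobian; exact: diff_proj_monotone. Qed.

Lemma shape_operator_jacobian x : tube P K x -> d x != 0 -> differentiable P x ->
  row_base (tangent_space d x) *m 'J P x =
  (1%:M + d x *: shape_operator d x) *m row_base (tangent_space d x).
Proof.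
move=> tx dx dP; have [dN dNv] := gauss_map_diff PG K0 PK dabs dsgn tx dx dP.
have gE := gradient_distance PG K0 PK dabs dsgn tx dx.
rewrite /shape_operator.
move: (row_base _) (eq_row_base (tangent_space d x)) => B BT.
have Bu i : dot (row i B) (x - P x) = 0.
  have : (row i B <= tangent_space d x)%MS.
    by rewrite -BT row_sub.
  move=> /sub_kermxP/matrixP/(_ 0 0); rewrite -dot_mx gE dotZr mxE => /eqP.
  by rewrite mulf_eq0 invr_eq0 (negbTE dx) => /eqP.
have BN : B *m 'J (gauss_map d) x = (d x)^-1 *: (B - B *m 'J P x).
  apply/row_matrixP => i; rewrite row_mul mul_jacobian dNv //.
  rewrite -mul_jacobian -row_mul; apply/rowP => j; rewrite !mxE.
  by congr (_ * (_ - _)); apply: eq_bigr => k _; rewrite !mxE.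
apply: restrict_affine dx _ BN; rewrite BT; apply/sub_kermxP.
rewrite -mulmxA mulmx_tr_eq0 ?mulmx0 // => v.
by rewrite mul_jacobian gE dotZr (diff_proj_normal PG K0 PK) // mulr0.
Qed.

Lemma J_factor_off x s : m = 1%N \/ m = 2%N ->
  tube P K x -> d x != 0 -> differentiable P x -> singular_values ('J P x) s ->
  J_factor d (d x) x = if m == 1%N then s`_0 else s`_0 * s`_1.
Proof.
move=> m12 tx dx dP sA; have gE := gradient_distance PG K0 PK dabs dsgn tx dx.
have xP : x - P x != 0 by rewrite -enorm_eq0 -dabs normr_eq0.
have u0 : gradient d x != 0 by rewrite gE scaler_eq0 negb_or invr_eq0 dx.
have rk : \rank (tangent_space d x) = m by rewrite mxrank_ker mxrank_tr rank_rV u0 subn1.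
rewrite /J_factor /signed_curvature /mean_curvature /gaussian_curvature.
rewrite -(det_one_plus (shape_operator d x) (d x) m12 rk) -(prod_singular _ m12).
apply: det_restrict_kernel u0 _ _ (shape_operator_jacobian tx dx dP) _ sA.
- by rewrite mul_jacobian gE linearZ /= (diff_proj_kernel PG) // scaler0.
- apply: mulmx_tr_eq0 => v.
  by rewrite mul_jacobian gE dotZr (diff_proj_normal PG K0 PK) // mulr0.
- by move=> v; exact: jacobian_ge0.
Qed.

End JacobianFactor.

(** * Points of the hypersurface *)

Lemma diff_comp_apply (R : realType) (U V W : normedModType R) (f : U -> V) (g : V -> W) x y v :
  f x = y -> differentiable f x -> differentiable g y ->
  'd (g \o f) x v = 'd g y ('d f x v).
Proof. by move=> <- df dg; exact: (congr1 (fun h => h v) (diff_comp df dg)). Qed.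

Lemma diff_left_inverse (R : realType) (U V : normedModType R) (f : U -> V) (g : V -> U) x v :
  differentiable f x -> differentiable g (f x) ->
  (\forall y \near x, g (f y) = y) -> 'd g (f x) ('d f x v) = v.
Proof.
move=> df dg gfK.
apply: etrans (esym (diff_comp_apply v erefl df dg)) _.
have idgf : \forall y \near x, id y = (g \o f) y by apply: filterS gfK => y /= ->.
have did : is_diff x id (id : U -> U) by exact: is_diff_id.
apply: etrans (congr1 (fun h => h v) (near_eq_diff idgf (@ex_diff _ _ _ _ _ _ _ did)).2) _.
exact: (congr1 (fun h => h v) (@diff_val _ _ _ _ _ _ _ did)).
Qed.

(** A differential in a direction v depends only on the values on a ray. *)
Lemma diff_eq_ray (R : realType) (V : normedModType R) n (f g : V -> 'rV[R]_n.+1) x v :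
  differentiable f x -> differentiable g x -> f x = g x ->
  (\forall t \near (0 : R)^'+, f (x + t *: v) = g (x + t *: v)) ->
  'd f x v = 'd g x v.
Proof.
move=> df dg fgx fg; apply/eqP; rewrite -subr_eq0 -dot_eq0; apply/eqP.
have dfg : is_diff x (fun z => f z - g z) (fun v => 'd f x v - 'd g x v).
  exact: (is_diffB (differentiableP df) (differentiableP dg)).
have dD := @ex_diff _ _ _ _ _ _ _ dfg.
have h e : 0 <= dot ('d f x v - 'd g x v) e.
  have -> : dot ('d f x v - 'd g x v) e = 'd (fun z => dot (f z - g z) e) x v.
    apply: esym; apply: etrans (diff_dot e v dD) _; congr (dot _ _).
    exact: (congr1 (fun h => h v) (@diff_val _ _ _ _ _ _ _ dfg)).
  apply: (@diff_ge0 _ _ _ _ _ 0); first exact: differentiable_dot.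
  by apply: filterS fg => t ->; rewrite fgx !subrr dot0l mul0r subr0.
move: (_ - _) h => w h; apply/eqP; rewrite eq_le dot_ge0 andbT.
by have := h (- w); rewrite dotNr oppr_ge0.
Qed.

(** Test the nonnegativity on u - (D u) / 2: the value is - |D u|^2 / 4. In other
words, a monotone projection is an orthogonal projection. *)
Lemma monotone_projection_kernel (R : realType) n
    (D : {linear 'rV[R]_n -> 'rV[R]_n}) (u : 'rV[R]_n) :
  (forall v, dot (D v) u = 0) -> (forall v, dot v u = 0 -> D v = v) ->
  (forall v, 0 <= dot (D v) v) -> D u = 0.
Proof.
move=> Du DK Dge0; have DDu := DK _ (Du u).
have := Dge0 (u - 2^-1 *: D u).
rewrite linearB linearZ /= DDu !dotE Du => h.
apply/eqP; rewrite -dot_eq0; apply/eqP.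
have := dot_ge0 (D u); lra.
Qed.

Section OnHypersurface.
Variables (R : realType) (m : nat) (Gamma : set 'rV[R]_m.+1).
Variables (P : 'rV[R]_m.+1 -> 'rV[R]_m.+1).
Hypothesis PG : closest_point_map Gamma P.
Variables (U V : set 'rV[R]_m.+1) (Phi Psi : 'rV[R]_m.+1 -> 'rV[R]_m.+1).
Hypothesis dPP : C2_diffeomorphism U V Phi Psi.
Variable x : 'rV[R]_m.+1.
Hypotheses (Ux : U x) (Gx : Gamma x) (dP : differentiable P x).

Let Px : P x = x. Proof. exact: (proj_id PG Gx). Qed.
Let dPhi : differentiable Phi x. Proof. by case: dPP => [[_ _ [[h _] _] _] _]; exact: h. Qed.
Let Vx : V (Phi x). Proof. by case: dPP => _ [h _ _ _]; exact: h. Qed.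
Let dPsi : differentiable Psi (Phi x).
Proof. by case: dPP => [[_ _ _ [[h _] _]] _]; exact: h. Qed.
Let PsiPhi : Psi (Phi x) = x. Proof. by case: dPP => _ [_ _ h _]; exact: h. Qed.

Lemma chart_diffK v : 'd Psi (Phi x) ('d Phi x v) = v.
Proof.
apply: diff_left_inverse => //; case: dPP => [[oU _ _ _] [_ _ h _]].
by apply: filterS (open_nbhs_nbhs (conj oU Ux)) => y; exact: h.
Qed.

Lemma chart_diffVK w : 'd Phi x ('d Psi (Phi x) w) = w.
Proof.
have h := @diff_left_inverse _ _ _ Psi Phi (Phi x) w dPsi; rewrite PsiPhi in h.
apply: h => //; case: dPP => [[_ oV _ _] [_ _ _ h]].
by apply: filterS (open_nbhs_nbhs (conj oV Vx)) => y; exact: h.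
Qed.

(** P fixes the curve t |-> Psi (Phi x + t w), so P' fixes its velocity. *)
Lemma diff_proj_tangent w :
  (\forall t \near (0 : R)^'+, Gamma (Psi (Phi x + t *: w))) ->
  'd P x ('d Psi (Phi x) w) = 'd Psi (Phi x) w.
Proof.
move=> Gw; apply: etrans (esym (diff_comp_apply w PsiPhi dPsi dP)) _.
apply: diff_eq_ray => //.
  by apply: differentiable_comp => //; rewrite PsiPhi.
  by rewrite /= PsiPhi Px.
by apply: filterS Gw => t Gt /=; rewrite (proj_id PG Gt).
Qed.

Lemma diff_chart_proj v e :
  'd (fun z => dot (Phi (P z)) e) x v = dot ('d Phi x ('d P x v)) e.
Proof.
have dPhi' : differentiable Phi (P x) by rewrite Px.
have dc : differentiable (Phi \o P) x by exact: differentiable_comp.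
apply: etrans (diff_dot e v dc) _; congr (dot _ _).
exact: diff_comp_apply.
Qed.

Lemma differentiable_chart_proj e : differentiable (fun z => dot (Phi (P z)) e) x.
Proof.
have dPhi' : differentiable Phi (P x) by rewrite Px.
have dc : differentiable (Phi \o P) x by exact: differentiable_comp.
exact: (differentiable_dot e dc).
Qed.

Lemma near_proj_chart : \forall z \near x, U (P z).
Proof.
have oU : open U by case: dPP => [[]].
have cP : {for x, continuous P} by exact: differentiable_continuous.
by apply: cP; rewrite Px; exact: open_nbhs_nbhs.
Qed.

Lemma near_ray_chart w : \forall t \near (0 : R)^'+, V (Phi x + t *: w).
Proof. by apply: near_ray; apply: open_nbhs_nbhs; split=> //; case: dPP => [[]]. Qed.

Lemma chartK y : V y -> U (Psi y) /\ Phi (Psi y) = y.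
Proof. by move=> Vy; case: dPP => _ [_ h1 _ h2]; split; [exact: h1|exact: h2]. Qed.

(** The first coordinate of Phi o P is nonnegative and vanishes at x, so its derivative
at x is 0. But P fixes the curve Psi (Phi x + t e), along which this coordinate is t. *)
Lemma boundary_not_differentiable : (0 < m)%N -> Phi x ord0 ord0 = 0 ->
  (forall y, U y -> (Gamma y <-> Phi y ord0 ord_max = 0 /\ 0 <= Phi y ord0 ord0)) ->
  False.
Proof.
move=> m0 Phi0 GE; pose e : 'rV[R]_m.+1 := delta_mx ord0 ord0.
have e0 : dot e e = 1 by rewrite -coord_dot mxE !eqxx.
have emax : e ord0 ord_max = 0.
  by rewrite mxE eqxx /= -val_eqE /= eqn0Ngt m0.
have hge : \forall z \near x, 0 <= dot (Phi (P z)) e.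
  apply: filterS near_proj_chart => z /GE[+ _].
  by move=> /(_ (PG z).1)[_]; rewrite -coord_dot.
have ge0 v : 0 <= dot ('d Phi x ('d P x v)) e.
  rewrite -diff_chart_proj; apply: (@diff_ge0 _ _ _ _ _ 0).
    exact: differentiable_chart_proj.
  apply: filterS (near_ray v hge) => t.
  by rewrite mul0r subr0 Px -(coord_dot (Phi x)) Phi0.
have [xmax _] := (GE _ Ux).1 Gx.
have eG : \forall t \near (0 : R)^'+, Gamma (Psi (Phi x + t *: e)).
  near=> t; have t0 : 0 < t by near: t; exact: nbhs_right_gt.
  have Vt : V (Phi x + t *: e) by near: t; exact: near_ray_chart.
  have [Ut PhiK] := chartK Vt; apply/GE => //; rewrite PhiK.
  split; rewrite mxE [X in _ + X]mxE ?xmax ?Phi0 ?emax ?mulr0 ?addr0 //.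
  by rewrite mxE !eqxx mulr1 add0r ltW.
have Pe := diff_proj_tangent eG; have Phie := chart_diffVK e.
have := ge0 (- 'd Psi (Phi x) e).
have -> : dot ('d Phi x ('d P x (- 'd Psi (Phi x) e))) e = - 1.
  rewrite -e0 -dotNl; congr (dot _ _).
  apply: etrans (congr1 ('d Phi x) (linearN _ _)) _.
  apply: etrans (congr1 (fun w => 'd Phi x (- w)) Pe) _.
  by apply: etrans (linearN _ _) _; rewrite Phie.
by rewrite oppr_ge0 lt_geF.
Unshelve. all: by end_near. Qed.

Lemma interior_jacobian : (forall y, U y -> (Gamma y <-> Phi y ord0 ord_max = 0)) ->
  exists u : 'rV[R]_m.+1, [/\ u != 0, 'd P x u = 0,
    forall v, dot ('d P x v) u = 0 & forall v, dot v u = 0 -> 'd P x v = v].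
Proof.
move=> GE; pose e : 'rV[R]_m.+1 := delta_mx ord0 ord_max.
pose u : 'rV[R]_m.+1 := \row_i dot ('d Phi x (delta_mx ord0 i)) e.
have uE v : dot v u = dot ('d Phi x v) e.
  have -> : 'd Phi x v = \sum_i v ord0 i *: 'd Phi x (delta_mx ord0 i).
    rewrite {1}(row_sum_delta v) linear_sum; apply: eq_bigr => i _.
    exact: linearZ.
  rewrite -[RHS]/(dotl e _) linear_sum; apply: eq_bigr => i _.
  by rewrite mxE /= /dotl dotZl.
have hu v : dot ('d P x v) u = 0.
  suff h w : 0 <= dot ('d P x w) u.
    have := h v; have := h (- v).
    rewrite linearN dotNl oppr_ge0 => h1 h2; apply/eqP.
    by rewrite eq_le h1 h2.
  rewrite uE -diff_chart_proj; apply: (@diff_ge0 _ _ _ _ _ 0).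
    exact: differentiable_chart_proj.
  have h0 : \forall z \near x, dot (Phi (P z)) e = 0.
    apply: filterS near_proj_chart => z /GE[+ _].
    by move=> /(_ (PG z).1); rewrite -coord_dot.
  by apply: filterS (near_ray w h0) => t ->; rewrite (nbhs_singleton h0) mul0r subr0.
have hv v : dot v u = 0 -> 'd P x v = v.
  rewrite uE => ve; have k := chart_diffK v.
  have Gv : \forall t \near (0 : R)^'+, Gamma (Psi (Phi x + t *: 'd Phi x v)).
    near=> t.
    have Vt : V (Phi x + t *: 'd Phi x v) by near: t; exact: near_ray_chart.
    have [Ut PhiK] := chartK Vt; apply/GE => //; rewrite PhiK.
    rewrite coord_dot dotDl dotZl ve mulr0 addr0 -coord_dot.
    exact: (GE _ Ux).1.
  exact: etrans (congr1 ('d P x) (esym k)) (etrans (diff_proj_tangent Gv) k).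
exists u; split=> //.
  apply: contraTneq isT => u0; have := uE ('d Psi (Phi x) e).
  rewrite u0 dotC dot0l chart_diffVK -coord_dot mxE !eqxx => /eqP.
  by rewrite eq_sym oner_eq0.
by apply: monotone_projection_kernel hu hv _ => v; exact: (diff_proj_monotone PG).
Unshelve. all: by end_near. Qed.

End OnHypersurface.

(** * Differentiability of the closest point mapping *)

Lemma is_diff_big_sum (R : realType) (V W : normedModType R) (I : Type) (r : seq I)
    (F : I -> V -> W) (dF : I -> V -> W) x :
  (forall i, is_diff x (F i) (dF i)) ->
  is_diff x (fun z => \sum_(i <- r) F i z) (fun v => \sum_(i <- r) dF i v).
Proof.
move=> h; elim: r => [|i r IHr].
  have -> : (fun z => \sum_(i <- [::]) F i z) = cst 0 by apply/funext => z; rewrite big_nil.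
  have -> : (fun z => \sum_(i <- [::]) dF i z) = 0 by apply/funext => z; rewrite big_nil.
  exact: is_diff_cst.
have -> : (fun z => \sum_(j <- i :: r) F j z) = F i + (fun z => \sum_(j <- r) F j z).
  by apply/funext => z; rewrite big_cons.
have -> : (fun z => \sum_(j <- i :: r) dF j z) = dF i + (fun z => \sum_(j <- r) dF j z).
  by apply/funext => z; rewrite big_cons.
exact: (is_diffD (h i) IHr).
Qed.

Lemma is_diff_dot2 (R : realType) (V : normedModType R) n (f g : V -> 'rV[R]_n.+1) x :
  differentiable f x -> differentiable g x ->
  is_diff x (fun z => dot (f z) (g z))
    (fun v => dot ('d f x v) (g x) + dot (f x) ('d g x v)).
Proof.
move=> df dg.
have dc (k : V -> 'rV[R]_n.+1) i : differentiable k x ->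
    is_diff x (fun z => k z ord0 i) (fun v => 'd k x v ord0 i).
  move=> dk; have -> : (fun z => k z ord0 i) = (fun z => dot (k z) (delta_mx ord0 i)).
    by apply/funext => z; rewrite coord_dot.
  apply: DiffDef; first exact: differentiable_dot.
  by apply/funext => v; rewrite coord_dot; exact: diff_dot.
have -> : (fun v => dot ('d f x v) (g x) + dot (f x) ('d g x v)) =
    (fun v => \sum_i (f x ord0 i *: 'd g x v ord0 i + g x ord0 i *: 'd f x v ord0 i)).
  apply/funext => v; rewrite addrC /dot -big_split /=; apply: eq_bigr => i _.
  by rewrite [X in _ + X]mulrC.
by apply: is_diff_big_sum => i; exact: (is_diffM (dc f i df) (dc g i dg)).
Qed.

Lemma differentiable_dot2 (R : realType) (V : normedModType R) n
    (f g : V -> 'rV[R]_n.+1) x :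
  differentiable f x -> differentiable g x -> differentiable (fun z => dot (f z) (g z)) x.
Proof. by move=> df dg; exact: (@ex_diff _ _ _ _ _ _ _ (is_diff_dot2 df dg)). Qed.

(** The factor y - x vanishes at x, so k matters only through its value at x, and
continuity of k suffices. *)
Lemma differentiable_dot_vanishing (R : realType) n (k : 'rV[R]_n.+1 -> 'rV[R]_n.+1) x :
  {for x, continuous k} -> differentiable (fun y => dot (y - x) (k y)) x.
Proof.
move=> ck; have [] // : is_diff x (fun y => dot (y - x) (k y)) (dotl (k x)).
apply: approx_is_diff => [|e e0]; first exact: linear_rV_continuous.
pose N : R := n.+1%:R; have N0 : 0 < N by rewrite ltr0n.
have e1 : 0 < e / (N * N) by rewrite divr_gt0 // mulr_gt0.
have /cvgrPdist_le/(_ _ e1) := ck.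
apply: filterS => y ky; rewrite subrr dot0l subr0 /= /dotl -dotBr.
apply: le_trans (normr_dot_le _ _) _; rewrite mulrC.
have h1 := enorm_le_norm (k y - k x); have h2 := enorm_le_norm (y - x).
apply: le_trans (ler_pM (enorm_ge0 _) (enorm_ge0 _) h1 h2) _.
rewrite mulrACA mulrA ler_wpM2r // (distrC (k y)).
by rewrite -(ler_pdivlMl _ _ (mulr_gt0 N0 N0)) mulrC.
Qed.

(** Invert the differential of E in the expansion of E (b y) - E (b x); the error is a
little o of b y - b x, hence of y - x by the Lipschitz bound. *)
Lemma differentiable_of_comp (R : realType) n k (b : 'rV[R]_n.+1 -> 'rV[R]_k.+1)
    (E : 'rV[R]_k.+1 -> 'rV[R]_k.+1) x C :
  (\forall y \near x, `|b y - b x| <= C * `|y - x|) ->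
  differentiable (E \o b) x -> differentiable E (b x) ->
  (forall h, 'd E (b x) h = 0 -> h = 0) -> differentiable b x.
Proof.
move=> bC dEb dE inj; pose T := 'J E (b x).
have Tu : T \in unitmx.
  rewrite -row_free_unit -kermx_eq0; apply/rowV0P => v /sub_kermxP.
  by rewrite mul_jacobian => /inj.
have [c c0 hc] := linear_lipschitz (@linear_rV_continuous _ _ _ (mulmxr (invmx T))).
have [] // : is_diff x b (mulmxr ('J (E \o b) x *m invmx T)).
apply: approx_is_diff => [|e e0]; first exact: linear_rV_continuous.
have C1 : 0 < `|C| + 1 by rewrite ltr_wpDl.
have e1 : 0 < e / (2 * c) by rewrite divr_gt0 ?mulr_gt0.
have e2 : 0 < e / (2 * c * (`|C| + 1)) by rewrite divr_gt0 ?mulr_gt0.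
have cb : {for x, continuous b}.
  apply/(@cvgrPdist_le _ _ _ _ (nbhs_filter x)) => eps eps0.
  have : 0 < eps / (`|C| + 1) by rewrite divr_gt0.
  move=> /(nbhsx_ballx x) hb; apply: filterS2 bC hb => y h1.
  rewrite -ball_normE /= ltr_pdivlMr // => h2; rewrite distrC.
  apply: le_trans h1 _; apply: le_trans (ltW h2).
  rewrite mulrC distrC ler_wpM2l //; have := ler_norm C; lra.
have hE := cb _ (differentiable_approx dE e2).
apply: filterS3 bC hE (differentiable_approx dEb e1) => y h1 h2 h3.
rewrite /= mulmxA mul_jacobian.
have -> : b y - b x = 'd E (b x) (b y - b x) *m invmx T.
  by rewrite -mul_jacobian mulmxK.
rewrite -mulmxBl; apply: le_trans (hc _) _.
have h4 : `|'d E (b x) (b y - b x) - 'd (E \o b) x (y - x)| <= e / c * `|y - x|.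
  have h4' : `|'d E (b x) (b y - b x) - 'd (E \o b) x (y - x)| <=
      e / (2 * c * (`|C| + 1)) * `|b y - b x| + e / (2 * c) * `|y - x|.
    apply: le_trans (ler_distD (E (b y) - E (b x)) _ _) _.
    by apply: lerD; [rewrite distrC; exact: h2|exact: h3].
  apply: (le_trans h4') => {h4'}.
  have h5 : e / (2 * c * (`|C| + 1)) * `|b y - b x| <= e / (2 * c) * `|y - x|.
    have -> : e / (2 * c) = e / (2 * c * (`|C| + 1)) * (`|C| + 1).
      by field; rewrite !gt_eqF.
    rewrite -[leRHS]mulrA ler_wpM2l ?(ltW e2) //; apply: le_trans h1 _.
    by rewrite ler_wpM2r //; have := ler_norm C; lra.
  have -> : e / c * `|y - x| = e / (2 * c) * `|y - x| + e / (2 * c) * `|y - x|.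
    by field; rewrite gt_eqF.
  by rewrite lerD2r.
apply: le_trans (ler_wpM2l (ltW c0) h4) _.
by rewrite mulrA mulrCA mulfV ?gt_eqF // mulr1.
Qed.

(** In this section P x is an interior point of Gamma, in the domain U of a chart. *)
Section ProjectionDifferentiable.
Variables (R : realType) (m : nat) (Gamma : set 'rV[R]_m.+1).
Variables (P : 'rV[R]_m.+1 -> 'rV[R]_m.+1) (K : R).
Hypothesis PG : closest_point_map Gamma P.
Hypothesis K0 : 0 < K.
Hypothesis PK : forall p q x, nearest Gamma x p -> Gamma q ->
  dot (x - p) (q - p) <= K * (enorm (x - p) * enorm (q - p) ^+ 2).
Variables (U V : set 'rV[R]_m.+1) (Phi Psi : 'rV[R]_m.+1 -> 'rV[R]_m.+1).
Hypothesis dPP : C2_diffeomorphism U V Phi Psi.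
Hypothesis GE : forall y, U y -> (Gamma y <-> Phi y ord0 ord_max = 0).
Variable x : 'rV[R]_m.+1.
Hypothesis tx : tube P K x.
Hypothesis UPx : U (P x).

Let b0 := Phi (P x).
Let oU : open U. Proof. by case: dPP => [[]]. Qed.
Let oV : open V. Proof. by case: dPP => [[]]. Qed.
Let UV y : U y -> V (Phi y). Proof. by case: dPP => _ [h _ _ _]; exact: h. Qed.
Let VU y : V y -> U (Psi y). Proof. by case: dPP => _ [_ h _ _]; exact: h. Qed.
Let PhiK y : U y -> Psi (Phi y) = y. Proof. by case: dPP => _ [_ _ h _]; exact: h. Qed.
Let PsiK y : V y -> Phi (Psi y) = y. Proof. by case: dPP => _ [_ _ _ h]; exact: h. Qed.
Let C1Phi : C1_on U Phi. Proof. by case: dPP => [[_ _ [h _] _] _]. Qed.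
Let C2Psi : C2_on V Psi. Proof. by case: dPP => [[_ _ _ h] _]. Qed.
Let dPsi a : V a -> differentiable Psi a. Proof. by move=> Va; exact: C2Psi.1.1. Qed.
Let Vb0 : V b0. Proof. exact: UV. Qed.

(** At an interior point of Gamma [nearest_tangent] applies to w and to - w. *)
Lemma proj_stationary y (w : 'rV[R]_m.+1) : U (P y) -> w ord0 ord_max = 0 ->
  dot (y - P y) ('d Psi (Phi (P y)) w) = 0.
Proof.
move=> UPy w0; set a := Phi (P y); have Va : V a by exact: UV.
have pE : Psi a = P y by exact: PhiK.
have a0 : a ord0 ord_max = 0 by apply/GE => //; exact: (PG y).1.
suff h (w' : 'rV[R]_m.+1) : w' ord0 ord_max = 0 -> dot (y - P y) ('d Psi a w') <= 0.
  have h1 := h w w0; have h2 : dot (y - P y) ('d Psi a (- w)) <= 0.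
    by apply: h; rewrite mxE w0 oppr0.
  have h3 : 'd Psi a (- w) = - 'd Psi a w by exact: linearN.
  by move: h2; rewrite h3 dotNr oppr_le0 => h2; apply/eqP; rewrite eq_le h1 h2.
move=> w'0; rewrite -pE; apply: (@nearest_tangent _ _ _ Gamma).
- exact: dPsi.
- by rewrite pE; exact: PG.
near=> t; have Vt : V (a + t *: w').
  by near: t; apply: near_ray; exact: open_nbhs_nbhs.
by apply/GE; [exact: VU|rewrite PsiK // !mxE a0 w'0 mulr0 addr0].
Unshelve. all: by end_near. Qed.

(** Minus the gradient of half the squared distance from x to Psi b along the
hyperplane b_m = 0, completed by b_m itself: it vanishes at the image of
the nearest point, and is a map between spaces of the same dimension. *)
Definition stationarity (b : 'rV[R]_m.+1) : 'rV[R]_m.+1 :=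
  \row_j if j == ord_max then b ord0 ord_max
         else dot (x - Psi b) ('D_(delta_mx ord0 j) Psi b).

Lemma dot_stationarity b (h : 'rV[R]_m.+1) : V b -> h ord0 ord_max = 0 ->
  dot (stationarity b) h = dot (x - Psi b) ('d Psi b h).
Proof.
move=> Vb h0; have -> : 'd Psi b h = \sum_j h ord0 j *: 'D_(delta_mx ord0 j) Psi b.
  exact/diff_row_sum/dPsi.
rewrite [RHS]dotC -[RHS]/(dotl _ _) linear_sum; apply: eq_bigr => j _.
rewrite mxE /= /dotl dotZl mulrC; case: eqP => [->|_]; first by rewrite h0 !mul0r.
by rewrite dotC.
Qed.

Lemma differentiable_stationarity : differentiable stationarity b0.
Proof.
apply: differentiable_rV => j; have [->|jm] := eqVneq j ord_max.
  rewrite (_ : (fun z => _) = (fun b : 'rV[R]_m.+1 => b ord0 ord_max)).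
    exact: differentiable_coord.
  by apply/funext => b; rewrite mxE eqxx.
rewrite (_ : (fun z => _) = (fun b => dot (x - Psi b) ('D_(delta_mx ord0 j) Psi b))); last first.
  by apply/funext => b; rewrite mxE (negbTE jm).
apply: differentiable_dot2.
  by apply: differentiableB; [exact: differentiable_cst|exact: dPsi].
exact: (C2Psi.2 _).1.
Qed.

Lemma diff_sqr_distance b h : V b ->
  'd (fun b => dot (x - Psi b) (x - Psi b)) b h = - 2 * dot (x - Psi b) ('d Psi b h).
Proof.
move=> Vb; have dx : is_diff b (fun b => x - Psi b) (fun v => - 'd Psi b v).
  have -> : (fun v => - 'd Psi b v) =
      (0 : 'rV[R]_m.+1 -> 'rV[R]_m.+1) - ('d Psi b : 'rV[R]_m.+1 -> 'rV[R]_m.+1).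
    by apply/funext => v; rewrite !fctE sub0r.
  exact: (is_diffB (is_diff_cst _ _) (differentiableP (dPsi Vb))).
have dd := @ex_diff _ _ _ _ _ _ _ dx.
apply: etrans (congr1 (fun k => k h) (@diff_val _ _ _ _ _ _ _ (is_diff_dot2 dd dd))) _.
have e1 : 'd (fun b => x - Psi b) b h = - 'd Psi b h.
  exact: (congr1 (fun k => k h) (@diff_val _ _ _ _ _ _ _ dx)).
apply: etrans (congr2 (fun u v => dot u (x - Psi b) + dot (x - Psi b) v) e1 e1) _.
by rewrite (dotC (- _)) dotNr; ring.
Qed.

(** Let h be in the kernel. Then h_m = 0, and the derivative of
F b = |x - Psi b|^2 in the direction h is o(t) at b0 + t h, so that
F (b0 + t h) - F b0 = o(t ^ 2) by the mean value theorem. On the other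
hand the inequality [PK] and the bound on the tube give
F (b0 + t h) - F b0 >= |z|^2 / 2 with z = Psi (b0 + t h) - P x, and |z| is at
least a multiple of t |h| because Phi is Lipschitz. *)
Lemma stationarity_injective h : 'd stationarity b0 h = 0 -> h = 0.
Proof.
move=> Eh; have dE := differentiable_stationarity.
have h0 : h ord0 ord_max = 0.
  rewrite coord_dot; have : dot ('d stationarity b0 h) (delta_mx ord0 ord_max) = 0.
    by rewrite Eh dot0l.
  move=> <-; apply: esym; apply: etrans (esym (diff_dot _ _ dE)) _.
  have -> : (fun z => dot (stationarity z) (delta_mx ord0 ord_max)) =
            (fun z => dot z (delta_mx ord0 ord_max)).
    by apply/funext => z; rewrite -!coord_dot mxE eqxx.
  have did : is_diff b0 (id : 'rV[R]_m.+1 -> _) id by exact: is_diff_id.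
  apply: etrans (diff_dot _ _ (@ex_diff _ _ _ _ _ _ _ did)) _; congr (dot _ _).
  exact: (congr1 (fun k => k h) (@diff_val _ _ _ _ _ _ _ did)).
apply/eqP; apply: contraT => hn0; have hgt : 0 < `|h| by rewrite normr_gt0.
pose N : R := m.+1%:R; have N0 : 0 < N by rewrite ltr0n.
have [L L0 hL] := C1_lipschitz oU C1Phi UPx.
have [r [r0 {}hL]] : exists r, 0 < r /\ forall y z, ball (P x) r y -> ball (P x) r z ->
    `|Phi z - Phi y| <= L * `|z - y|.
  near (0:R)^'+ => r; exists r.
  by split; [near: r; exact: nbhs_right_gt|near: r].
(* Chosen so that the bounds lower, upper and hz below are incompatible. *)
pose e := (8 * (N * N) * (L ^+ 2 + 1))^-1.
have e0 : 0 < e by rewrite invr_gt0 !mulr_gt0 // ltr_wpDl // sqr_ge0.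
have pE : Psi b0 = P x by exact: PhiK.
have : nbhs b0 [set b | V b /\ `|stationarity b - stationarity b0 -
    'd stationarity b0 (b - b0)| <= e * `|b - b0|].
  by apply: filterI (differentiable_approx dE e0); exact: open_nbhs_nbhs.
move=> /nbhs_ballP[s /= s0 hs].
have cPsi : \forall b \near b0, ball (P x) r (Psi b).
  have := differentiable_continuous (dPsi Vb0); apply; rewrite pE.
  exact: nbhsx_ballx.
near (0:R)^'+ => t; have t0 : 0 < t by near: t; exact: nbhs_right_gt.
have ts : t * `|h| < s.
  by rewrite -ltr_pdivlMr //; near: t; apply: nbhs_right_lt; rewrite divr_gt0.
have br : ball (P x) r (Psi (b0 + t *: h)) by near: t; exact: near_ray cPsi.
have bs c : 0 <= c <= 1 -> ball b0 s (b0 + c *: (t *: h)).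
  move=> /andP[c0 c1]; rewrite -ball_normE /= opprD addNKr normrN !normrZ.
  rewrite (ger0_norm c0) gtr0_norm //; apply: le_lt_trans ts.
  by rewrite ler_piMl // mulr_ge0 // ltW.
set z := Psi (b0 + t *: h) - P x.
have Vth : V (b0 + t *: h).
  by have [] := hs _ (bs 1 _); rewrite ?scale1r // ler01 lexx.
have lower : dot z z / 2 <=
    dot (x - Psi (b0 + t *: h)) (x - Psi (b0 + t *: h)) - dot (x - P x) (x - P x).
  have Gz : Gamma (Psi (b0 + t *: h)).
    apply/GE; first exact: VU.
    rewrite PsiK // !mxE h0 mulr0 addr0; apply/GE => //; exact: (PG x).1.
  have := PK (PG x) Gz; rewrite -/z enorm_sqr.
  have -> : x - Psi (b0 + t *: h) = (x - P x) - z by apply/rowP => i; rewrite !mxE; ring.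
  have := dot_ge0 z; move: tx; rewrite /tube /=.
  clearbody z; move: (x - P x) => w; rewrite !dotE (dotC z w).
  move: (dot z z) (dot w z) (enorm _) => zz xz rho tr zz0 hk.
  have : K * (rho * zz) <= 4^-1 * zz by rewrite mulrA ler_wpM2r //; lra.
  lra.
have upper : dot (x - Psi (b0 + t *: h)) (x - Psi (b0 + t *: h)) -
    dot (x - P x) (x - P x) <= 2 * (N * N) * e * (t * `|h|) ^+ 2.
  rewrite -pE.
  have [c c01|c c01] := @segment_MVT _ _ (fun b => dot (x - Psi b) (x - Psi b)) b0 (t *: h).
    have Vc : V (b0 + c *: (t *: h)) by have [] := hs _ (bs c c01).
    have dx : differentiable (fun b => x - Psi b) (b0 + c *: (t *: h)).
      by apply: differentiableB; [exact: differentiable_cst|exact: dPsi].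
    exact: differentiable_dot2.
  have c01' : 0 <= c <= 1 by case/andP: c01 => /ltW -> /ltW.
  have [Vc hc] := hs _ (bs c c01'); move: Vc hc; set bc := b0 + c *: (t *: h) => Vc hc.
  move=> ->; rewrite diff_sqr_distance // -dot_stationarity //; last by rewrite mxE h0 mulr0.
  rewrite dotZr.
  have q0 : dot (stationarity b0) h = 0.
    by rewrite dot_stationarity // pE; exact: proj_stationary.
  have bcE : bc - b0 = (c * t) *: h by rewrite /bc addrC addKr scalerA.
  have Ehc : 'd stationarity b0 (bc - b0) = 0.
    by rewrite bcE; apply: etrans (linearZ _ _) _; rewrite Eh; exact: scaler0.
  have hc' : `|stationarity bc - stationarity b0| <= e * (t * `|h|).
    move: hc; rewrite Ehc subr0 bcE normrZ => hc; apply: le_trans hc _.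
    have /andP[c0 c1] := c01'.
    rewrite ler_wpM2l ?(ltW e0) // ler_wpM2r // normrM (ger0_norm c0) gtr0_norm //.
    by rewrite ler_piMl // ltW.
  have : `|dot (stationarity bc) h| <= N * (e * (t * `|h|)) * (N * `|h|).
    rewrite -[dot _ h]subr0 -q0 -dotBl; apply: le_trans (normr_dot_le _ _) _.
    apply: ler_pM; rewrite ?enorm_ge0 ?enorm_le_norm //.
    by apply: le_trans (enorm_le_norm _) _; rewrite ler_wpM2l.
  rewrite ler_norml => /andP[+ _]; move: (dot _ h) => q hq.
  have := ler_wpM2l (ltW t0) hq; lra.
have hz : (t * `|h|) ^+ 2 <= L ^+ 2 * dot z z.
  have h1 : t * `|h| <= L * enorm z.
    have := hL (P x) _ (ballxx _ r0) br; rewrite PsiK // -/z -/b0.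
    rewrite [b0 + _ - b0]addrC addKr normrZ gtr0_norm // => h2.
    by apply: le_trans h2 _; rewrite ler_wpM2l // norm_le_enorm.
  by rewrite -enorm_sqr -exprMn ler_sqr ?nnegrE ?mulr_ge0 ?enorm_ge0 // ltW.
have th0 : 0 < (t * `|h|) ^+ 2 by rewrite exprn_gt0 // mulr_gt0.
have := le_trans lower upper; move: hz th0; move: (dot z z) (dot_ge0 z) (_ ^+ 2).
move=> zz zz0 A hA A0 hzz.
have eE : 2 * (N * N) * e = (4 * (L ^+ 2 + 1))^-1.
  by rewrite /e; field; rewrite !gt_eqF // ltr_wpDl // sqr_ge0.
rewrite eE in hzz; have L1 : 0 < 4 * (L ^+ 2 + 1) by rewrite mulr_gt0 // ltr_wpDl // sqr_ge0.
have : (4 * (L ^+ 2 + 1)) * (zz / 2) <= A.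
  by rewrite -ler_pdivlMl.
have : 0 <= L ^+ 2 * zz by rewrite mulr_ge0 // sqr_ge0.
lra.
Unshelve. all: by end_near. Qed.

Let cP : {for x, continuous P}.
Proof.
apply/(@cvgrPdist_le _ _ _ _ (nbhs_filter x)) => e e0.
have N0 : 0 < (2 * m.+1%:R : R) by rewrite mulr_gt0.
have hb := nbhsx_ballx x _ (divr_gt0 e0 N0).
apply: filterS2 (proj_near_lipschitz PG K0 PK tx) hb => y h1.
rewrite -ball_normE /= ltr_pdivlMr // distrC => /ltW h2; rewrite distrC.
apply: le_trans (norm_le_enorm _) _; apply: le_trans h1 _.
apply: le_trans h2; rewrite [leRHS]mulrC -mulrA ler_wpM2l //.
exact: enorm_le_norm.
Qed.

Lemma proj_differentiable : differentiable P x.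
Proof.
pose b y := Phi (P y).
have Unear : \forall y \near x, U (P y) by apply: cP; exact: open_nbhs_nbhs.
have cPhi : {for P x, continuous Phi}.
  by apply: differentiable_continuous; exact: C1Phi.1.
have db : differentiable b x.
  have [L L0 hL] := C1_lipschitz oU C1Phi UPx.
  have [r [r0 {}hL]] : exists r, 0 < r /\ forall y z, ball (P x) r y -> ball (P x) r z ->
      `|Phi z - Phi y| <= L * `|z - y|.
    near (0:R)^'+ => r; exists r.
    by split; [near: r; exact: nbhs_right_gt|near: r].
  have Pr : \forall y \near x, ball (P x) r (P y) by apply: cP; exact: nbhsx_ballx.
  apply: (@differentiable_of_comp _ _ _ b stationarity x (L * (2 * m.+1%:R))).
  - apply: filterS2 Pr (proj_near_lipschitz PG K0 PK tx) => y yr h1.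
    apply: le_trans (hL _ _ (ballxx _ r0) yr) _; rewrite -mulrA ler_wpM2l //.
    apply: le_trans (norm_le_enorm _) _; apply: le_trans h1 _.
    by rewrite -mulrA ler_wpM2l // enorm_le_norm.
  - apply: differentiable_rV => j; have [->|jm] := eqVneq j ord_max.
      have [] // := @near_eq_diff _ _ _ (cst 0) (fun z => stationarity (b z) ord0 ord_max) x.
      apply: filterS Unear => y Uy; rewrite mxE eqxx; apply: esym.
      by apply/GE => //; exact: (PG y).1.
    pose k y := 'D_(delta_mx ord0 j) Psi (b y).
    have ck : {for x, continuous k}.
      apply: (@continuous_comp _ _ _ b ('D_(delta_mx ord0 j) Psi)).
        exact: continuous_comp.
      exact: C2Psi.1.2.
    have dk := differentiableN (differentiable_dot_vanishing ck).
    apply: (near_eq_diff _ dk).1; apply: filterS Unear => y Uy.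
    rewrite mxE (negbTE jm) /= PhiK // -[x - P y](subrKA y) dotDl.
    have -> : dot (y - P y) ('D_(delta_mx ord0 j) Psi (b y)) = 0.
      rewrite deriveE; last exact/dPsi/UV.
      by apply: proj_stationary => //; rewrite mxE eqxx eq_sym (negbTE jm).
    by rewrite addr0 -opprB dotNl.
  - exact: differentiable_stationarity.
  - exact: stationarity_injective.
have dc : differentiable (Psi \o b) x by apply: differentiable_comp => //; exact: dPsi.
by apply: (near_eq_diff _ dc).1; apply: filterS Unear => y Uy /=; exact: PhiK.
Unshelve. all: by end_near. Qed.

End ProjectionDifferentiable.

(** * The product of the singular values *)

(** J is 1, and so is \det 1%:M, which [det_restrict_kernel] identifies with the product
of the singular values when P' is the identity on the orthogonal complement of u. *)
Lemma J_factor_on (R : realType) m (Gamma : set 'rV[R]_m.+1)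
    (d : 'rV[R]_m.+1 -> R) (P : 'rV[R]_m.+1 -> 'rV[R]_m.+1) x s :
  m = 1%N \/ m = 2%N -> closest_point_map Gamma P -> Gamma x ->
  (hypersurface_interior Gamma `|` hypersurface_boundary Gamma) x ->
  differentiable P x -> singular_values ('J P x) s ->
  J_factor d 0 x = if m == 1%N then s`_0 else s`_0 * s`_1.
Proof.
move=> m12 PG Gx GIB dP sA.
have -> : J_factor d 0 x = 1.
  by rewrite /J_factor; case: ifP => _; rewrite ?expr0n /= ?mulr0 !mul0r !addr0.
case: GIB => [[_ [U [V [Phi [Psi [dPP Ux GE]]]]]]|
              [_ [U [V [Phi [Psi [dPP Ux Phi0 GE]]]]]]]; last first.
  have m0 : (0 < m)%N by case: m12 => ->.
  by case: (boundary_not_differentiable PG dPP Ux Gx dP m0 Phi0 GE).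
have [u [u0 uP Pu uK]] := interior_jacobian PG dPP Ux Gx dP GE.
rewrite -(prod_singular _ m12); apply: etrans (esym (det1 R (\rank (kermx u^T)))) _.
apply: (@det_restrict_kernel _ _ ('J P x) u 1%:M s u0 _ _ _ _ sA).
- by rewrite mul_jacobian.
- by apply: mulmx_tr_eq0 => v; rewrite mul_jacobian.
- rewrite mul1mx; apply/row_matrixP => i; rewrite row_mul mul_jacobian; apply: uK.
  have : (row i (row_base (kermx u^T)) <= kermx u^T)%MS.
    by rewrite -(eq_row_base (kermx u^T)) row_sub.
  by move=> /sub_kermxP/matrixP/(_ 0 0); rewrite -dot_mx mxE.
- by move=> v; exact: (jacobian_ge0 PG).
Qed.

Theorem proposition2 (R : realType) (m : nat) (Gamma : set 'rV[R]_m.+1)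
    (d : 'rV[R]_m.+1 -> R) (P : 'rV[R]_m.+1 -> 'rV[R]_m.+1) :
  m = 1%N \/ m = 2%N ->
  compact_C2_hypersurface Gamma ->
  is_distance_function Gamma d ->
  closest_point_map Gamma P ->
  \forall eta \near (0 : R), forall x, level_set d eta x ->
    (hypersurface_interior Gamma (P x) -> differentiable P x) /\
    (differentiable P x -> forall sigma, singular_values ('J P x) sigma ->
       J_factor d eta x =
         if m == 1%N then sigma`_0 else sigma`_0 * sigma`_1).
Proof.
move=> m12 cG dG PG; have [K K0 PK] := normal_bound cG.
have dabs := normr_distance dG PG; have dsgn := distance_sign dG PG.
have K4 : 0 < (4 * K)^-1 by rewrite invr_gt0 mulr_gt0.
apply/nbhs_ballP; exists (4 * K)^-1 => //= eta.
rewrite -ball_normE /= sub0r normrN => etaK x dx.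
have tx : tube P K x.
  by rewrite /tube /= -dabs dx -(ltr_pdivlMl _ _ (mulr_gt0 _ K0)) // mulr1.
split=> [[_ [U [V [Phi [Psi [dPP UPx GE]]]]]]|dP s sA].
  exact: (proj_differentiable PG K0 PK dPP GE tx UPx).
rewrite -dx; have [d0|dn0] := eqVneq (d x) 0; last first.
  exact: (J_factor_off PG K0 PK dabs dsgn m12 tx dn0 dP sA).
have Gx : Gamma x.
  have /eqP : enorm (x - P x) = 0 by rewrite -dabs d0 normr0.
  by rewrite enorm_eq0 subr_eq0 => /eqP ->; exact: (PG x).1.
by rewrite d0; exact: (J_factor_on d m12 PG Gx (cG.2 _ Gx) dP sA).
Qed.
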